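(* Let $p$ be a prime, let $\nu$ be a positive integer and let $k\ge 0$ be an integer. Let $A$ be a finite abelian group of order $m$ such that $p\nmid m$. Then $$\mathrm{avg}_{p^{2\nu}}^{\rm H}(A\times\mathbb{Z}_{p^k})= mp^k\left(\frac{1}{3}-\frac{1}{6(p^k+1)}\right)-|R_{p^{2\nu}}(A)|\left(\frac{p^k+1}{12}+\frac{2-3\delta_p}{12(p^k+1)}\right),$$ where $\delta_p=1$ if $p=2$ and $\delta_p=0$ if $p$ is odd.
   Context: For a finite abelian group $G$ (written additively), $\mathbb{F}_{p^{2\nu}}[G]$ is the group algebra of $G$ over the finite field $\mathbb{F}_{p^{2\nu}}$ with $p^{2\nu}$ elements, with elements written $\sum_{g\in G}u_gY^g$. An abelian code in $\mathbb{F}_{p^{2\nu}}[G]$ is an ideal of $\mathbb{F}_{p^{2\nu}}[G]$, and $\mathcal{C}(p^{2\nu},G)$ is the set of all of them. The Hermitian inner product is $\langle u,v\rangle_{\rm H}=\sum_{g\in G}u_gv_g^{p^\nu}$; the Hermitian dual of a code $C$ is $C^{\perp_{\rm H}}=\{v\in\mathbb{F}_{p^{2\nu}}[G] : \langle c,v\rangle_{\rm H}=0 \text{ for all } c\in C\}$, and the Hermitian hull is $\mathcal{H}_{\rm H}(C)=C\cap C^{\perp_{\rm H}}$. The average dimension of the Hermitian hull is $$\mathrm{avg}_{p^{2\nu}}^{\rm H}(G)=\frac{\sum_{C\in\mathcal{C}(p^{2\nu},G)}\dim(\mathcal{H}_{\rm H}(C))}{|\mathcal{C}(p^{2\nu},G)|},$$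 where $\dim$ is the dimension over $\mathbb{F}_{p^{2\nu}}$. For a positive integer $q$ coprime to $|A|$, the $q$-cyclotomic class of $a\in A$ is $S_q(a)=\{q^i\cdot a : i=0,1,2,\dots\}$, and $R_{p^{2\nu}}(A)=\{a\in A : -p^\nu\cdot a\in S_{p^{2\nu}}(a)\}$. $\mathbb{Z}_{p^k}$ is the cyclic group of order $p^k$.
   Formalization: The case p = 2 with k = 0 is excluded, since the printed formula fails there: for trivial A and the field with 4^ν elements the average is 0 but the right-hand side is 1/8. *)

(* Defs.v *)
From HB Require Import structures.
From mathcomp Require Import all_boot all_order all_algebra.

Set Implicit Arguments.
Unset Strict Implicit.
Unset Printing Implicit Defensive.

Import GRing.Theory.

Local Open Scope ring_scope.

(* 'Z_n denotes Z/2Z for n = 1, and the case n = p ^ 0 is needed, so the cyclic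
   group of order n > 0 is taken on the ordinals 'I_n.-1.+1 instead. *)
Definition cyclicZ (n : nat) : finZmodType := 'I_n.-1.+1.

Lemma card_cyclicZ n : (0 < n)%N -> #|cyclicZ n| = n.
Proof. by move=> n_gt0; rewrite card_ord prednK. Qed.

HB.instance Definition _ (A B : finZmodType) := Finite.on (A * B)%type.

(* u : galg F G stands for \sum_g u_g Y^g. This is an alias because the
   canonical ring structure of {ffun G -> F} has the pointwise product. *)
Definition galg (F : finFieldType) (G : finZmodType) : Type := {ffun G -> F^o}.

Section GroupAlgebra.
Variables (F : finFieldType) (G : finZmodType).

HB.instance Definition _ := Finite.copy (galg F G) {ffun G -> F^o}.
HB.instance Definition _ := GRing.Lmodule.copy (galg F G) {ffun G -> F^o}.
HB.instance Definition _ := Vector.copy (galg F G) {ffun G -> F^o}.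

Implicit Types u v w : galg F G.

Definition coef u : G -> F := fun g => (u : {ffun G -> F^o}) g.

Definition monom (g : G) : galg F G :=
  ([ffun x => (x == g)%:R] : {ffun G -> F^o}).

Definition galg_mul u v : galg F G :=
  ([ffun g => \sum_h coef u h * coef v (g - h)] : {ffun G -> F^o}).

Lemma galg_ext u v : (forall g, coef u g = coef v g) -> u = v.
Proof. by move=> uv; apply/ffunP. Qed.

Lemma coefD u v g : coef (u + v) g = coef u g + coef v g.
Proof. by rewrite /coef ffunE. Qed.

Lemma coefZ (a : F) u g : coef (a *: u) g = a * coef u g.
Proof. by rewrite /coef ffunE. Qed.

Lemma coef_monom x g : coef (monom x) g = (g == x)%:R.
Proof. by rewrite /coef ffunE. Qed.

Lemma coef_mul u v g : coef (galg_mul u v) g = \sum_h coef u h * coef v (g - h).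
Proof. by rewrite /coef ffunE. Qed.

Lemma galg_mulC : commutative galg_mul.
Proof.
move=> u v; apply: galg_ext => g; rewrite !coef_mul.
rewrite (reindex_inj (inj_comp (addrI g) oppr_inj)) /=.
by apply: eq_bigr => h _; rewrite subKr mulrC.
Qed.

Lemma galg_mul1 : left_id (monom 0) galg_mul.
Proof.
move=> u; apply: galg_ext => g; rewrite coef_mul (bigD1 0) //= coef_monom eqxx.
rewrite mul1r subr0 big1 ?addr0 // => h /negPf h0.
by rewrite coef_monom h0 mul0r.
Qed.

Lemma galg_mulDl : left_distributive galg_mul +%R.
Proof.
move=> u v w; apply: galg_ext => g; rewrite coefD !coef_mul -big_split /=.
by apply: eq_bigr => h _; rewrite coefD mulrDl.
Qed.

Lemma galg_mulA : associative galg_mul.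
Proof.
move=> u v w; apply: galg_ext => g; rewrite !coef_mul.
under eq_bigr do rewrite coef_mul mulr_sumr.
under [RHS]eq_bigr do rewrite coef_mul mulr_suml.
rewrite [RHS]exchange_big /=; apply: eq_bigr => h _.
rewrite [RHS](reindex_inj (addrI h)) /=; apply: eq_bigr => l _.
by rewrite mulrA [h + l - h]addrC addKr opprD addrA.
Qed.

Lemma galg_1_neq0 : monom 0 != 0.
Proof.
apply/eqP => /(congr1 (fun u => coef u 0)); rewrite coef_monom eqxx.
by rewrite /coef ffunE => /eqP; rewrite oner_eq0.
Qed.

HB.instance Definition _ := GRing.Zmodule_isComNzRing.Build (galg F G)
  galg_mulA galg_mulC galg_mul1 galg_mulDl galg_1_neq0.

Lemma galg_scaleAl (a : F) u v : a *: (u * v) = (a *: u) * v.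
Proof.
apply: galg_ext => g; rewrite coefZ !coef_mul mulr_sumr.
by apply: eq_bigr => h _; rewrite coefZ mulrA.
Qed.

HB.instance Definition _ :=
  GRing.Lmodule_isLalgebra.Build F (galg F G) galg_scaleAl.

Lemma galg_scaleAr (a : F) u v : a *: (u * v) = u * (a *: v).
Proof. by rewrite mulrC galg_scaleAl mulrC. Qed.

HB.instance Definition _ :=
  GRing.Lalgebra_isAlgebra.Build F (galg F G) galg_scaleAr.

Lemma monomM (g h : G) : monom g * monom h = monom (g + h).
Proof.
apply: galg_ext => x; rewrite coef_mul coef_monom (bigD1 g) //= !coef_monom eqxx.
rewrite mul1r big1 ?addr0 => [|y /negPf yg]; last by rewrite coef_monom yg mul0r.
by rewrite subr_eq addrC.
Qed.

Lemma galg_sumE u : u = \sum_g coef u g *: monom g.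
Proof.
have coef_sum (f : G -> galg F G) x :
  coef (\sum_g f g) x = \sum_g coef (f g) x.
  by rewrite /coef sum_ffunE.
apply: galg_ext => x; rewrite coef_sum (bigD1 x) //= coefZ coef_monom eqxx.
rewrite mulr1 big1 ?addr0 // => y /negPf yx.
by rewrite coefZ coef_monom eq_sym yx mulr0.
Qed.

(* mathcomp's idealr_closed excludes the unit ideal, which is a code here. *)
Definition is_ideal (C : {set galg F G}) : bool :=
  [&& 0 \in C,
      [forall u in C, forall v in C, u + v \in C] &
      [forall a, forall u in C, a * u \in C]].

Definition abelian_codes : {set {set galg F G}} := [set C | is_ideal C].

(* Dimension over F of the subspace spanned by C, i.e. of C itself when C is a
   subspace. *)
Definition code_dim (C : {set galg F G}) : nat := \dim <<enum C>>%VS.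

Section Hermitian.
Variables p nu : nat.

Definition herm u v : F := \sum_g coef u g * coef v g ^+ (p ^ nu).

Definition herm_dual (C : {set galg F G}) : {set galg F G} :=
  [set v | [forall c in C, herm c v == 0]].

Definition herm_hull (C : {set galg F G}) : {set galg F G} :=
  C :&: herm_dual C.

Definition avg_herm_hull : rat :=
  (\sum_(C in abelian_codes) (code_dim (herm_hull C))%:R) / #|abelian_codes|%:R.

End Hermitian.
End GroupAlgebra.

Arguments avg_herm_hull : clear implicits.

Section Cyclotomic.
Variable A : finZmodType.

Definition cyclotomic_class (q : nat) (a : A) : {set A} :=
  [set b in orbit (fun x : A => x *+ q) a].

Lemma cyclotomic_classP q (a b : A) :
  reflect (exists i, b = a *+ (q ^ i)) (b \in cyclotomic_class q a).
Proof.
have itE i : iter i (fun x : A => x *+ q) a = a *+ (q ^ i).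
  by elim: i => [|i /= ->]; rewrite ?expn0 ?mulr1n // -mulrnA -expnSr.
rewrite inE -fconnect_orbit; apply: (iffP idP) => [ab|[i ->]].
  by exists (findex (fun x : A => x *+ q) a b); rewrite -itE iter_findex.
by rewrite -itE fconnect_iter.
Qed.

Definition herm_R (p nu : nat) : {set A} :=
  [set a | - (a *+ (p ^ nu)) \in cyclotomic_class (p ^ (2 * nu)) a].

End Cyclotomic.

Arguments herm_R : clear implicits.

Definition delta (p : nat) : rat := (p == 2%N)%:R.

(* Main.v *)
Require Import Defs.
From mathcomp Require Import all_boot all_order all_algebra.
From HB Require Import structures.
From mathcomp Require Import all_field all_fingroup all_solvable.
From mathcomp Require Import ring zify.

(* Write q = p^nu, N = p^k and y = Y^(0,1) - 1 in R = F[A x Z/N]. Then y^N = 0,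
   and a suitable power M of #|F| makes x |-> x^M a ring retraction of R onto
   F[A] with kernel yR. Hence on each primitive idempotent e the component eR is
   a chain ring, with ideals the y^n eR for n <= N, and a code is a choice of one
   exponent n_e per primitive idempotent.
   The conjugation [bar], u_g Y^g |-> u_g^q Y^-g, is an involution of R and
   <u, v>_H is the coefficient at 0 of u * bar v. So the dual of the code with
   exponents n_e has exponents N - n_(bar e), and its hull has exponents
   max(n_e, N - n_(bar e)). Averaging reduces to sums of minima, over one
   exponent if bar e = e and over two independent ones otherwise.
   It remains to see that the dimensions of the fields e F[A] with bar e = e add
   up to the size of R_(q^2)(A). The F-linear map tau : u |-> (bar u)^q permutes
   the basis Y^a by a |-> -q a as well as the primitive idempotents. Let
   T = tau^j with j the odd part of the order of tau. In either description F[A]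
   is a direct sum U + W + W', where T is the identity on U, the self-conjugate
   part, and exchanges W and W'. Hence |Fix T|^2 = |U| |Fix T^2|, so that |U| is
   the same for both. *)

Import FinRing.Theory GRing.Theory.
Local Open Scope ring_scope.

Set Implicit Arguments.
Unset Strict Implicit.
Unset Printing Implicit Defensive.


(** * Ideals of a finite product of chain rings *)

Section PrimitiveIdempotents.
Variable R : finComNzRingType.

Definition primidem (e : R) : bool :=
  [&& e != 0, e * e == e &
      [forall f, (f * f == f) && (f * e == f) ==> (f == 0) || (f == e)]].

Local Notation I := {e : R | primidem e}.

Lemma primidem_neq0 (i : I) : val i != 0.
Proof. by case: i => e /= /and3P[]. Qed.

Lemma primidem_idem (i : I) : val i * val i = val i.
Proof. by case: i => e /= /and3P[_ /eqP]. Qed.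

Lemma primidem_min (i : I) f : f * f = f -> f * val i = f -> f = 0 \/ f = val i.
Proof.
case: i => e /= /and3P[_ _ /forallP/(_ f)] + ff fe; rewrite ff fe !eqxx /=.
by case/orP => /eqP; [left | right].
Qed.

Lemma primidem_orth (i j : I) : i != j -> val i * val j = 0.
Proof.
move=> ij; have ee := primidem_idem i; have ff := primidem_idem j.
set e := val i in ee *; set f := val j in ff *.
have idem : e * f * (e * f) = e * f by rewrite mulrACA ee ff.
have efe : e * f * e = e * f by rewrite mulrAC ee.
have eff : e * f * f = e * f by rewrite -mulrA ff.
case: (primidem_min idem efe) => // eq_e; case: (primidem_min idem eff) => // eq_f.
by case/eqP: ij; apply: val_inj; rewrite -eq_e -eq_f.
Qed.

(** Among the nonzero idempotents below f, one whose principal ideal gR has least cardinality is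
    primitive: a nonzero idempotent h below g has hR inside gR, hence hR = gR, so g is a multiple of
    h and h = g. *)
Lemma primidem_exists (f : R) : f * f = f -> f != 0 ->
  exists i : I, val i * f = val i.
Proof.
move=> ff f0.
pose Q g := [&& g != 0, g * g == g & g * f == g].
have Qf : Q f by rewrite /Q f0 ff !eqxx.
case: (arg_minnP (fun g : R => #|[set g * x | x : R]|) Qf) => g /and3P[g0 /eqP gg /eqP
  gf] gmin.
suff gP : primidem g by exists (Sub g gP).
rewrite /primidem g0 gg eqxx /=; apply/forallP => h; apply/implyP => /andP[/eqP hh /eqP hg].
have [//|h0] := eqVneq h 0.
have sub : [set h * x | x : R] \subset [set g * x | x : R].
  by apply/subsetP => _ /imsetP[x _ ->]; rewrite -hg -mulrA mulrCA imset_f.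
have le : (#|[set (g * x)%R | x : R]| <= #|[set (h * x)%R | x : R]|)%N.
  by apply: gmin; rewrite /Q h0 hh -hg -mulrA gf !eqxx.
have eq_im : [set h * x | x : R] = [set g * x | x : R].
  by apply/eqP; rewrite eqEcard sub.
have : g * 1 \in [set h * x | x : R] by rewrite eq_im imset_f.
case/imsetP => x _; rewrite mulr1 => gE.
by rewrite -hg {1}gE mulrA hh -gE eqxx orbT.
Qed.

(** If the sum s were not 1, then 1 - s would be a nonzero idempotent with a primitive one below it;
    but 1 - s is orthogonal to every primitive idempotent. *)
Lemma primidem_sum : \sum_(i : I) val i = 1.
Proof.
set s := \sum_i _.
have es (i : I) : val i * s = val i.
  rewrite mulr_sumr (bigD1 i) //= primidem_idem big1 ?addr0 // => j ji.
  by rewrite primidem_orth // eq_sym.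
have ss : s * s = s by rewrite {1}/s mulr_suml; apply: eq_bigr => i _; exact: es.
apply/eqP; rewrite eq_sym -subr_eq0; apply/negP => /negP s1.
have [|i] := @primidem_exists (1 - s) _ s1.
  by rewrite mulrBr mulr1 mulrBl mul1r ss subrr subr0.
rewrite mulrBr mulr1 es subrr => /esym/eqP.
by rewrite (negPf (primidem_neq0 i)).
Qed.

Lemma primidem_split (x : R) : x = \sum_(i : I) val i * x.
Proof. by rewrite -mulr_suml primidem_sum mul1r. Qed.

Lemma primidem_proj (x : I -> R) (i : I) :
  (forall j, val j * x j = x j) -> val i * (\sum_j x j) = x i.
Proof.
move=> xE; rewrite mulr_sumr (bigD1 i) //= xE big1 ?addr0 // => j ji.
by rewrite -xE mulrA primidem_orth ?mul0r // eq_sym.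
Qed.

(** Chinese remaindering: an element is a free choice of its components. *)
Lemma card_primidem_components (B : I -> {set R}) :
  (forall i x, x \in B i -> val i * x = x) ->
  #|[set x | [forall i : I, val i * x \in B i]]| = (\prod_i #|B i|)%N.
Proof.
move=> BE; transitivity #|family (fun i => mem (B i))|; last first.
  by rewrite card_family foldrE big_map big_enum.
have famE (f : {ffun I -> R}) (i : I) : f \in family (fun i => mem (B i)) ->
    val i * \sum_j f j = f i.
  by move=> /familyP fB; apply: primidem_proj => j; apply: BE; exact: fB.
rewrite -(@card_in_imset _ _ (fun f : {ffun I -> R} => \sum_i f i)).
  apply: eq_card => x; rewrite inE; apply/forallP/imsetP => [xB|[f fB ->] i].
    exists [ffun i => val i * x]; first by apply/familyP => i; rewrite ffunE; exact: xB.
    by rewrite {1}[x]primidem_split; apply: eq_bigr => i _; rewrite ffunE.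
  by rewrite famE //; move/familyP: fB => /(_ i).
move=> f g fB gB /= fg; apply/ffunP => i.
by rewrite -(famE _ _ fB) -(famE _ _ gB) fg.
Qed.

(** The idempotents below [s e] correspond under s to those below e. This lets the conjugation act
    on the primitive idempotents. *)
Lemma primidem_rmorph (s : R -> R) (e : R) : s 0 = 0 -> {morph s : x y / x * y} ->
  involutive s -> primidem e -> primidem (s e).
Proof.
move=> s0 sM sK /and3P[e0 /eqP ee /forallP emin].
rewrite /primidem -sM ee eqxx /= (inv_eq sK) s0 e0 /=.
apply/forallP => f; apply/implyP => /andP[/eqP ff /eqP fe].
have /implyP := emin (s f); rewrite -sM ff eqxx -{1}[e]sK -sM fe eqxx.
by rewrite !(inv_eq sK) s0 => ->.
Qed.

(** When a^M = a, the power a^(M-1) is an idempotent of the component, so it is 0 or the unit of the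
    component; accordingly a is zero or invertible there. *)
Lemma primidem_mul_eq0 (i : I) (M : nat) (a b : R) : (1 < M)%N ->
  a ^+ M = a -> val i * a = a -> val i * b = b -> a * b = 0 -> a = 0 \/ b = 0.
Proof.
move=> M_gt1 aM ea eb ab; set f := a ^+ M.-1.
have af : a * f = a by rewrite -exprS prednK // ltnW.
have fE : f = a * a ^+ M.-2 by rewrite -exprS /f prednK // -subn1 subn_gt0.
have ff : f * f = f by rewrite {1}fE mulrAC af -fE.
have fe : f * val i = f by rewrite mulrC fE mulrA ea.
have [f0|fi] := primidem_min ff fe; first by left; rewrite -af f0 mulr0.
by right; rewrite -eb -fi fE mulrAC ab mul0r.
Qed.

(** Used to find a root: a product of linear factors that vanishes on a component has a factor
    vanishing there. *)
Lemma primidem_prod_eq0 (i : I) (M : nat) (s : seq R) : (1 < M)%N ->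
  {in s, forall a, (val i * a) ^+ M = val i * a} ->
  val i * \prod_(a <- s) a = 0 -> exists2 a, a \in s & val i * a = 0.
Proof.
move=> M_gt1; elim: s => [_|a s IHs aM].
  by rewrite big_nil mulr1 => /eqP; rewrite (negPf (primidem_neq0 i)).
rewrite big_cons => eas.
have as0 : val i * a * (val i * \prod_(b <- s) b) = 0 by rewrite mulrACA primidem_idem.
have ee x : val i * (val i * x) = val i * x by rewrite mulrA primidem_idem.
have aM' := aM _ (mem_head _ _).
have [a0|bs0] := primidem_mul_eq0 M_gt1 aM' (ee a) (ee _) as0.
  by exists a; rewrite ?mem_head.
have [|b bs b0] := IHs _ bs0; last by exists b; rewrite // inE bs orbT.
by move=> b bs; apply: aM; rewrite inE bs orbT.
Qed.

End PrimitiveIdempotents.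

(** * Components that are chain rings with uniformizer y *)

Section ChainComponents.
Variables (R : finComNzRingType) (y : R) (N M : nat).
Local Notation I := {e : R | primidem e}.
Hypotheses (N_gt0 : (0 < N)%N) (M_gt1 : (1 < M)%N).
Hypothesis powD : forall x z : R, (x + z) ^+ M = x ^+ M + z ^+ M.
Hypothesis powK : forall x : R, (x ^+ M) ^+ M = x ^+ M.
Hypothesis subr_pow : forall x : R, exists z, x - x ^+ M = y * z.
Hypothesis yN : y ^+ N = 0.
Hypothesis y_free : forall x : R, x ^+ M = x -> y ^+ N.-1 * x = 0 -> x = 0.

Lemma primidem_pow (i : I) n : val i ^+ n.+1 = val i.
Proof. by elim: n => // n IHn; rewrite exprS IHn primidem_idem. Qed.

Lemma primidem_powM (i : I) : val i ^+ M = val i.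
Proof. by case: M M_gt1 => // n _; rewrite primidem_pow. Qed.

(** The component is local with maximal ideal generated by y. With t = x^M, the idempotent t^(M-1)
    is 0 or e. If it is 0, then t = 0 and x = x - x^M lies in yR; otherwise x^(M-1) t^(M-2) inverts
    x. *)
Lemma unit_or_dvdy (i : I) (x : R) : val i * x = x ->
  (exists z, x * z = val i) \/ (exists z, x = y * z).
Proof.
move=> ex; set t := x ^+ M; set f := t ^+ M.-1.
have tM : t * f = t by rewrite -exprS prednK ?powK // ltnW.
have ft : f = t * t ^+ M.-2 by rewrite -exprS /f prednK // -subn1 subn_gt0.
have ff : f * f = f by rewrite {1}ft mulrAC tM -ft.
have et : t * val i = t by rewrite /t -{1}ex exprMn primidem_powM mulrAC primidem_idem
  -{1}(primidem_powM i) -exprMn ex.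
have fe : f * val i = f by rewrite ft mulrAC et.
have [f0|fE] := primidem_min ff fe; [right | left].
  have t0 : t = 0 by rewrite -tM f0 mulr0.
  by have [z] := subr_pow x; rewrite -/t t0 subr0 => ->; exists z.
by exists (x ^+ M.-1 * t ^+ M.-2); rewrite mulrA -exprS (prednK (ltnW M_gt1)) -/t -ft.
Qed.

Lemma primidem_ypow_neq0 (i : I) n : (n < N)%N -> y ^+ n * val i != 0.
Proof.
move=> nN; apply/eqP => y0; have /eqP := primidem_neq0 i; apply.
apply: y_free (primidem_powM i) _.
have -> : N.-1 = (N.-1 - n + n)%N by rewrite subnK // -ltnS prednK.
by rewrite exprD -mulrA y0 mulr0.
Qed.

Lemma ypow_eq0 n : (N <= n)%N -> y ^+ n = 0.
Proof. by move=> /subnKC <-; rewrite exprD yN mul0r. Qed.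

Definition dvdy (n : nat) (x : R) : bool := [exists z, x == y ^+ n * z].

Lemma dvdyP n x : reflect (exists z, x = y ^+ n * z) (dvdy n x).
Proof. by apply: (iffP existsP) => [] [z]; [move/eqP|move->]; exists z. Qed.

Lemma dvdy_max a b x : dvdy (maxn a b) x = dvdy a x && dvdy b x.
Proof.
have sub m n z : (m <= n)%N -> dvdy n z -> dvdy m z.
  move=> mn /dvdyP[u ->]; apply/dvdyP; exists (y ^+ (n - m) * u).
  by rewrite mulrA -exprD subnKC.
apply/idP/andP => [d|[da db]]; last by case: leqP.
by split; apply: sub d; rewrite ?leq_maxl ?leq_maxr.
Qed.

(** Here n is the least exponent with y^n e in J. If an element of J is y^m z with m < n, then z is
    not a unit, since y^m e would be in J; so y divides z and m can grow up to n. [J] is a predicate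
    so as to cover codes and annihilators alike. *)
Lemma component_ideal (i : I) (J : R -> bool) n :
  (forall a x, J x -> J (a * x)) -> J (y ^+ n * val i) ->
  (forall m, (m < n)%N -> ~~ J (y ^+ m * val i)) ->
  forall x, J (val i * x) = dvdy n (val i * x).
Proof.
move=> JM Jn Jmin x; apply/idP/dvdyP => [|[z xE]]; last first.
  have -> : val i * x = z * (y ^+ n * val i); last exact: JM.
  by rewrite -{1}primidem_idem -mulrA xE [LHS]mulrCA [RHS]mulrCA [z * _]mulrC.
move=> Jx; suff: forall m, (m <= n)%N -> exists z, val i * x = y ^+ m * (val i * z).
  by case/(_ n (leqnn n)) => z ->; exists (val i * z).
elim=> [|m IHm] mn; first by exists x; rewrite mul1r.
have [z xE] := IHm (ltnW mn).
have [|[u zu]|[u zu]] := @unit_or_dvdy i (val i * z); first by rewrite mulrA primidem_idem.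
  by case/negP: (Jmin m mn); rewrite -zu mulrA -xE mulrC JM.
exists u; rewrite exprSr -[RHS]mulrA -{1}primidem_idem -mulrA xE zu.
by rewrite mulrCA [val i * (y * _)]mulrCA.
Qed.

Definition code_of (n : {ffun I -> 'I_N.+1}) : {set R} :=
  [set x | [forall i : I, dvdy (n i) (val i * x)]].

Lemma code_ofP (n : {ffun I -> 'I_N.+1}) x : reflect (forall i : I, dvdy (n i) (val i *
  x)) (x \in code_of n).
Proof. by rewrite inE; exact: forallP. Qed.

Lemma dvdy0 n : dvdy n 0.
Proof. by apply/dvdyP; exists 0; rewrite mulr0. Qed.

Lemma dvdyD n x z : dvdy n x -> dvdy n z -> dvdy n (x + z).
Proof. by move=> /dvdyP[u ->] /dvdyP[v ->]; apply/dvdyP; exists (u + v);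
  rewrite mulrDr. Qed.

Lemma dvdyM n a x : dvdy n x -> dvdy n (a * x).
Proof. by move=> /dvdyP[u ->]; apply/dvdyP; exists (a * u); rewrite mulrCA. Qed.

Lemma code_of_ideal n :
  [/\ 0 \in code_of n,
      forall u v, u \in code_of n -> v \in code_of n -> u + v \in code_of n &
      forall a u, u \in code_of n -> a * u \in code_of n].
Proof.
split=> [|u v /code_ofP nu /code_ofP nv|a u /code_ofP nu]; apply/code_ofP => i.
- by rewrite mulr0 dvdy0.
- by rewrite mulrDr dvdyD.
- by rewrite mulrCA dvdyM.
Qed.

Lemma mem_ideal_components (C : {set R}) x : 0 \in C ->
  (forall u v, u \in C -> v \in C -> u + v \in C) ->
  (forall a u, u \in C -> a * u \in C) ->
  (x \in C) = [forall i : I, val i * x \in C].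
Proof.
move=> C0 CD CM; apply/idP/forallP => [xC i|xC]; first exact: CM.
by rewrite [x]primidem_split; elim/big_ind: _ => // i _; exact: xC.
Qed.

Lemma ideal_code_of (C : {set R}) : 0 \in C ->
  (forall u v, u \in C -> v \in C -> u + v \in C) ->
  (forall a u, u \in C -> a * u \in C) -> exists n, C = code_of n.
Proof.
move=> C0 CD CM.
(* The exponent at i is the least m with y^m e in C; it is at most N because y^N = 0. *)
have exn (i : I) : exists m, y ^+ m * val i \in C by exists N; rewrite yN mul0r.
have le_n (i : I) : (ex_minn (exn i) <= N)%N.
  by case: ex_minnP => m _; apply; rewrite yN mul0r.
exists [ffun i => inord (ex_minn (exn i))]; apply/setP => x.
rewrite mem_ideal_components // inE; apply: eq_forallb => i.
rewrite ffunE inordK ?ltnS ?le_n //; case: ex_minnP => m mC mmin.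
apply: (component_ideal (J := fun x => x \in C)) => // l.
by apply: contraL => /mmin; rewrite -leqNgt.
Qed.

Lemma dvdy_ypow (i : I) (m n : nat) : (m <= N)%N -> (n <= N)%N ->
  dvdy n (val i * (y ^+ m * val i)) = (n <= m)%N.
Proof.
move=> mN nN; rewrite mulrCA primidem_idem; apply/dvdyP/idP => [[z yE]|nm].
  rewrite leqNgt; apply/negP => mn.
  (* If m < n, multiplying by y^(N-n) would kill y^m e, although N - n + m < N. *)
  have := @primidem_ypow_neq0 i (N - n + m); rewrite exprD -mulrA yE mulrA -exprD.
  rewrite subnK // yN mul0r eqxx => /(_ _)/negP; apply=> //.
  by rewrite -{2}(subnK nN) ltn_add2l.
by exists (y ^+ (m - n) * val i); rewrite mulrA -exprD subnKC.
Qed.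

Lemma ypow_primidem_in_code (i : I) (m : nat) (n : {ffun I -> 'I_N.+1}) : (m <= N)%N ->
  (y ^+ m * val i \in code_of n) = (n i <= m)%N.
Proof.
move=> mN; rewrite -(@dvdy_ypow i) ?leq_ord //.
apply/code_ofP/idP => [/(_ i) //|d j].
have [-> //|ji] := eqVneq j i.
by rewrite mulrCA primidem_orth // mulr0 dvdy0.
Qed.

Lemma code_of_inj : injective code_of.
Proof.
move=> n n' eq_nn; apply/ffunP => i; apply/val_inj/eqP.
have le (a b : {ffun I -> 'I_N.+1}) : code_of a = code_of b -> (a i <= b i)%N.
  by move=> ab; rewrite -ypow_primidem_in_code ?leq_ord // ab ypow_primidem_in_code
    ?leq_ord.
by rewrite eqn_leq !le.
Qed.

Lemma annihilator_component (i : I) (n : nat) x : (n <= N)%N ->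
  (y ^+ n * (val i * x) == 0) = dvdy (N - n) (val i * x).
Proof.
move=> nN; apply: (component_ideal (J := fun x => y ^+ n * x == 0)) => /=.
- by move=> a z /eqP z0; rewrite mulrCA z0 mulr0.
- by rewrite mulrA -exprD subnKC // yN mul0r.
move=> m mn; rewrite mulrA -exprD primidem_ypow_neq0 //.
by rewrite -ltn_subRL.
Qed.

Definition level (i : I) (n : nat) : {set R} :=
  [set x | (val i * x == x) && dvdy n x].

(* [x |-> x ^+ M] being a retraction with kernel [y R], its fixed points on the
   component of [i] represent the residue field of that component. *)
Definition residue (i : I) : {set R} := [set x | (val i * x == x) && (x ^+ M == x)].

(** Each step down the filtration by powers of y contributes one residue field: an element of level
    n' is uniquely y^n' a + z with a in [residue i] and z of level n' + 1. *)
Lemma card_level (i : I) (n : nat) : (n <= N)%N ->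
  #|level i n| = (#|residue i| ^ (N - n))%N.
Proof.
move=> nN; rewrite -{1}(subKn nN); elim: (N - n)%N (leq_subr n N) => [|k IHk] kN.
  rewrite subn0 expn0; apply: (@eq_card1 _ 0) => x; rewrite !inE.
  apply/andP/eqP => [[_ /dvdyP[z ->]]|->]; first by rewrite yN mul0r.
  by rewrite mulr0 dvdy0.
rewrite expnS -IHk ?(ltnW kN) //; set n' := (N - k.+1)%N.
have -> : (N - k = n'.+1)%N by rewrite /n' subnSK.
rewrite -cardsX -(@card_in_imset _ _ (fun az => y ^+ n' * az.1 + az.2)).
  apply: eq_card => x; apply/idP/imsetP => [|[[a z] /= /setXP[/=]]]; last first.
    rewrite !inE => /andP[/eqP ea _] /andP[/eqP ez dz] ->.
    rewrite mulrDr mulrCA ea ez eqxx dvdyD //; first by apply/dvdyP; exists a.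
    by move: dz; rewrite -(maxn_idPl (leqnSn n')) dvdy_max => /andP[].
  rewrite inE => /andP[/eqP ex /dvdyP[z xE]].
  (* The digit a is the M-th power of the cofactor, which differs from the cofactor by a multiple of
     y. *)
  have [w zw] := subr_pow (val i * z).
  exists ((val i * z) ^+ M, y ^+ n'.+1 * (val i * w)) => /=.
    have ea : val i * (val i * z) ^+ M = (val i * z) ^+ M.
      by rewrite exprMn primidem_powM mulrA primidem_idem.
    apply/setXP; rewrite !inE /= ea powK !eqxx mulrCA [val i * (_ * w)]mulrA.
    by rewrite primidem_idem eqxx; split=> //; apply/dvdyP; exists (val i * w).
  have ez : val i * (val i * z) = val i * z by rewrite mulrA primidem_idem.
  have -> : x = y ^+ n' * (val i * z) by rewrite mulrCA -xE ex.
  rewrite exprSr -mulrA -mulrDr; congr (_ * _); rewrite mulrCA -zw mulrBr ez.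
  by rewrite exprMn primidem_powM mulrA primidem_idem addrC subrK.
move=> [a z] [a' z'] /setXP[/= aP zP] /setXP[/= a'P z'P] /= eqs.
suff aa : a = a' by move: eqs; rewrite aa => /addrI ->.
move: aP a'P zP z'P; rewrite !inE => /andP[_ /eqP aM] /andP[_ /eqP a'M].
move=> /andP[_ /dvdyP[u zE]] /andP[_ /dvdyP[u' z'E]].
have eqd : y ^+ n' * (a - a') = y ^+ n'.+1 * (u' - u).
  by rewrite !mulrBr -zE -z'E; apply/eqP;
    rewrite subr_eq -addrA [- z + _]addrC addrA [z' + _]addrC -eqs addrK.
(* Uniqueness: a - a' is again fixed by the M-th power, and multiplying the relation by y^k turns
   its left side into y^(N-1) (a - a') and its right side into 0. *)
apply/eqP; rewrite -subr_eq0; apply/eqP/y_free.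
  have := powD (a - a') a'; rewrite subrK aM a'M => ->; by rewrite addrK.
have -> : N.-1 = (k + n')%N by rewrite /n'; case: N kN => // l kl; rewrite subSS subnKC.
rewrite exprD -mulrA eqd mulrA -exprD ypow_eq0 ?mul0r // addnS -addSn /n'.
by rewrite subnKC.
Qed.

Lemma card_code_of (n : {ffun I -> 'I_N.+1}) : #|code_of n| = (\prod_i #|residue i| ^
  (N - n i))%N.
Proof.
under eq_bigr => i _ do rewrite -card_level ?leq_ord //.
rewrite -card_primidem_components => [|i x]; last by rewrite inE => /andP[/eqP].
apply: eq_card => x; rewrite !inE; apply: eq_forallb => i.
by rewrite inE mulrA primidem_idem eqxx.
Qed.

End ChainComponents.


(** * Counting fixed points *)

Section Swap.
Variables (V : finZmodType) (X : {set V}) (T : V -> V) (pr : option bool -> V -> V).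
Hypothesis XD : forall x z, x \in X -> z \in X -> x + z \in X.
Hypothesis TX : forall x, x \in X -> T x \in X.
Hypothesis prX : forall k x, x \in X -> pr k x \in X.
Hypothesis TD : {morph T : x z / x + z}.
Hypothesis prD : forall k, {morph pr k : x z / x + z}.
Hypothesis pr_pr : forall k l x, pr k (pr l x) = if k == l then pr l x else 0.
Hypothesis pr_sum : forall x, x \in X ->
  x = pr None x + pr (Some true) x + pr (Some false) x.
Hypothesis T_pr : forall k x, T (pr k x) = pr (omap negb k) (T x).
Hypothesis T_id : forall x, x \in X -> T (pr None x) = pr None x.

(** The maps [pr] split X into a part U ([None]) on which T is the identity and two parts exchanged
    by T. With W the elements of the part [Some true] fixed by T^2, a fixed point of T is a + b + T
    b, and one of T^2 is a + b + T c, with a in U and b, c in W. So the counts are |U||W| and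
    |U||W|^2. *)
Lemma card_fixed_swap :
  (#|[set x in X | T x == x]| ^ 2 =
   #|[set x in X | pr None x == x]| * #|[set x in X | T (T x) == x]|)%N.
Proof.
pose U := [set x in X | pr None x == x].
pose W := [set x in X | (pr (Some true) x == x) && (T (T x) == x)].
have UP a : a \in U -> [/\ a \in X, pr None a = a & T a = a].
  rewrite inE => /andP[aX /eqP aE]; split=> //.
  by rewrite -aE T_id.
have WP b : b \in W -> [/\ b \in X, pr (Some true) b = b & T (T b) = b].
  by rewrite inE => /and3P[? /eqP ? /eqP ?].
have UI x : x \in X -> pr None x \in U by move=> xX; rewrite inE prX //= pr_pr eqxx.
have comb a b c : a \in U -> b \in W -> c \in W ->
    [/\ pr None (a + b + T c) = a, pr (Some true) (a + b + T c) = b &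
        pr (Some false) (a + b + T c) = T c].
  move=> /UP[aX aE _] /WP[bX bE _] /WP[cX cE _].
  have tc : pr (Some false) (T c) = T c by rewrite -{2}cE T_pr.
  rewrite !prD -aE -bE -tc !pr_pr /= !addr0 ?add0r.
  by split.
have card1 : #|[set x in X | T x == x]| = (#|U| * #|W|)%N.
  rewrite -cardsX -(@card_in_imset _ _ (fun ab => ab.1 + ab.2 + T ab.2)).
    apply: eq_card => x; rewrite inE; apply/andP/imsetP => [[xX /eqP Tx]|].
      have wE : T (pr (Some true) x) = pr (Some false) x by rewrite T_pr Tx.
      have w'E : T (pr (Some false) x) = pr (Some true) x by rewrite T_pr Tx.
      exists (pr None x, pr (Some true) x); last by rewrite wE -pr_sum.
      by apply/setXP; split; [exact: UI | rewrite inE prX //= pr_pr wE w'E !eqxx].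
    case=> [[a b] /setXP[/= aU bW] ->]; have [aX _ Ta] := UP a aU;
      have [bX _ Tb] := WP b bW.
    by rewrite !XD ?TX // !TD Ta Tb addrAC.
  move=> [a b] [a' b'] /setXP[/= aU bW] /setXP[/= aU' bW'] /= E.
  have [ea eb _] := comb a b b aU bW bW; have [ea' eb' _] := comb a' b' b' aU' bW' bW'.
  by congr (_, _); [rewrite -ea E ea' | rewrite -eb E eb'].
have card2 : #|[set x in X | T (T x) == x]| = (#|U| * (#|W| * #|W|))%N.
  rewrite -!cardsX -(@card_in_imset _ _ (fun ab => ab.1 + ab.2.1 + T ab.2.2)).
    apply: eq_card => x; rewrite inE; apply/andP/imsetP => [[xX /eqP Tx]|].
      have wE : T (T (pr (Some true) x)) = pr (Some true) x by rewrite !T_pr Tx.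
      have w'E : T (T (pr (Some false) x)) = pr (Some false) x by rewrite !T_pr Tx.
      exists (pr None x, (pr (Some true) x, T (pr (Some false) x)));
        last by rewrite /= w'E -pr_sum.
      apply/setXP; split; first exact: UI.
      apply/setXP; split; rewrite inE ?TX ?prX //= ?wE ?w'E ?T_pr pr_pr !eqxx //=.
    case=> [[a [b c]] /setXP[/= aU /setXP[/= bW cW]] ->].
    have [aX _ Ta] := UP a aU; have [bX _ Tb] := WP b bW; have [cX _ Tc] := WP c cW.
    by rewrite !XD ?TX // !TD !Ta Tb Tc.
  move=> [a [b c]] [a' [b' c']] /setXP[/= aU /setXP[/= bW cW]] /setXP[/= aU' /setXP[/=
    bW' cW']] /= E.
  have [ea eb ec] := comb a b c aU bW cW; have [ea' eb' ec'] := comb a' b' c' aU' bW' cW'.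
  have [_ _ Tc] := WP c cW; have [_ _ Tc'] := WP c' cW'.
  by congr (_, (_, _)); [rewrite -ea E ea' | rewrite -eb E eb' | rewrite -Tc -ec E ec' Tc'].
by rewrite card1 card2 -/U -mulnn mulnACA -mulnA.
Qed.
End Swap.

(** Bezout in the subtraction-free form u a = v b + gcd, since f need not be invertible. *)
Lemma iter_gcd_fixed (S : Type) (f : S -> S) (x : S) (a b : nat) : (0 < a)%N ->
  iter a f x = x -> iter b f x = x -> iter (gcdn a b) f x = x.
Proof.
move=> a_gt0 fa fb.
have fix_mul c d : iter c f x = x -> iter (d * c) f x = x.
  by move=> fc; elim: d => //= d IHd; rewrite mulSn iterD IHd.
have := fix_mul a (egcdn a b).1 fa; case: egcdnP => //= u v -> _.
by rewrite addnC iterD fix_mul.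
Qed.

(* An orbit of odd length has length dividing the odd part of every period. *)
Lemma iter_odd_part_fixed (S : Type) (f : S -> S) (x : S) (l n : nat) : (0 < n)%N ->
  odd l -> iter l f x = x -> iter n f x = x -> iter (n`_2^')%N f x = x.
Proof.
move=> n_gt0 odd_l fl fn.
have := iter_gcd_fixed n_gt0 fn fl; set g := gcdn n l => fg.
have g_odd : odd g by apply: contraLR odd_l; rewrite -!dvdn2 => d2g;
  exact: dvdn_trans d2g (dvdn_gcdr _ _).
have : (g %| n`_2^')%N.
  rewrite -(@Gauss_dvdr _ (n`_2)%N); first by rewrite partnC // dvdn_gcdl.
  by rewrite p_part coprimeXr // coprimen2.
case/dvdnP => d ->; elim: d => //= d IHd.
by rewrite mulSn iterD IHd.
Qed.

(** With l + 1 a positive multiple of the period 2h, f^l acts as an inverse of f at x. Applying it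
    to f^(2n) x = f x gives the period l + 2n, which is odd. *)
Lemma iter_odd_period (S : Type) (f : S -> S) (x : S) (n h : nat) : (0 < h)%N ->
  iter h.*2 f x = x -> iter n.*2 f x = f x -> iter (h.*2`_2^')%N f x = x.
Proof.
move=> h_gt0 fh fn; set l := (n.+1 * h.*2).-1.
have l1 : l.+1 = (n.+1 * h.*2)%N by rewrite prednK // muln_gt0 double_gt0.
have fl1 : iter l.+1 f x = x.
  by rewrite l1; elim: n.+1 => // d IHd; rewrite mulSn iterD IHd.
apply: (@iter_odd_part_fixed _ _ _ (l + n.*2)) => //; first by rewrite double_gt0.
  by rewrite oddD odd_double addbF -[odd l]negbK -/(odd l.+1) l1 -doubleMr odd_double.
by rewrite iterD fn -iterSr.
Qed.

Lemma sum_option_bool (V : nmodType) (f : option bool -> V) :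
  \sum_k f k = f None + f (Some true) + f (Some false).
Proof.
rewrite (bigD1 None) // (bigD1 (Some true)) // (bigD1 (Some false)) //= big_pred0.
  by rewrite addr0 addrA.
by case=> [[]|].
Qed.



(** * The group algebra and its conjugation *)

(** The morphism permutes the roots cyclically, hence fixes the product. *)
Lemma coef_prod_orbit (R : comNzRingType) (phi : {rmorphism R -> R})
    (u : nat -> R) (h j : nat) :
  (forall n, phi (u n) = u n.+1) -> u h.+1 = u 0%N ->
  phi (\prod_(n < h.+1) ('X - (u n)%:P))`_j = (\prod_(n < h.+1) ('X - (u n)%:P))`_j.
Proof.
move=> phiu uh; rewrite -coef_map; set f := \prod_(n < _) _.
suff -> : map_poly phi f = f by [].
have E n : map_poly phi ('X - (u n)%:P) = 'X - (u n.+1)%:P.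
  by rewrite rmorphB /= map_polyX map_polyC /= phiu.
rewrite rmorph_prod /=; under eq_bigr do rewrite E.
by rewrite big_ord_recr [RHS]big_ord_recl /= uh mulrC.
Qed.

Section GroupAlgebra.
Variables (F : finFieldType) (G : finZmodType).
Implicit Types (u v : galg F G) (g h : G).

Lemma galg_coef_sum (I : Type) (r : seq I) (P : pred I) (f : I -> galg F G) g :
  coef (\sum_(i <- r | P i) f i) g = \sum_(i <- r | P i) coef (f i) g.
Proof.
elim/big_rec2: _ => [|i x u _ IHu]; last by rewrite Defs.coefD IHu.
by rewrite /coef ffunE.
Qed.

Lemma monomX g n : monom F g ^+ n = monom F (g *+ n).
Proof. by elim: n => // n IHn; rewrite exprS IHn monomM mulrS. Qed.

Lemma coef_monomM g u h : coef (monom F g * u) h = coef u (h - g).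
Proof.
rewrite coef_mul (bigD1 g) //= coef_monom eqxx mul1r big1 ?addr0 // => l /negPf lg.
by rewrite coef_monom lg mul0r.
Qed.

Section Frobenius.
Variable p : nat.
Hypothesis pcharF : p \in [pchar F].

Lemma pchar_galg : p \in [pchar galg F G].
Proof. exact: (rmorph_pchar (GRing.in_alg (galg F G)) pcharF). Qed.

Lemma galg_expD n u v : (u + v) ^+ (p ^ n) = u ^+ (p ^ n) + v ^+ (p ^ n).
Proof.
apply: exprDn_pchar; rewrite pnatX; apply/orP; left.
by rewrite (eq_pnat _ (pcharf_eq pchar_galg)) pnat_id // (pcharf_prime pcharF).
Qed.

Lemma field_expD n (a b : F) : (a + b) ^+ (p ^ n) = a ^+ (p ^ n) + b ^+ (p ^ n).
Proof.
apply: exprDn_pchar; rewrite pnatX; apply/orP; left.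
by rewrite (eq_pnat _ (pcharf_eq pcharF)) pnat_id // (pcharf_prime pcharF).
Qed.

Lemma galg_exp n u :
  u ^+ (p ^ n) = \sum_g coef u g ^+ (p ^ n) *: monom F (g *+ (p ^ n)).
Proof.
have p_gt0 := prime_gt0 (pcharf_prime pcharF).
rewrite {1}[u]galg_sumE (big_morph _ (galg_expD n) (id1 := 0)); last first.
  by rewrite expr0n expn_eq0 eqn0Ngt p_gt0.
by apply: eq_bigr => g _; rewrite exprZn monomX.
Qed.

End Frobenius.
End GroupAlgebra.

Section Bar.
Variables (F : finFieldType) (G : finZmodType) (p nu : nat).
Hypothesis pcharF : p \in [pchar F].
Hypothesis cardF : #|F| = (p ^ (2 * nu))%N.
Implicit Types (u v : galg F G) (g h : G) (c : F).

Local Notation q := (p ^ nu)%N.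

Lemma expq_q (R : pzRingType) (x : R) : (x ^+ q) ^+ q = x ^+ (p ^ (2 * nu)).
Proof. by rewrite -exprM -expnD addnn mul2n. Qed.

Lemma field_expqK c : (c ^+ q) ^+ q = c.
Proof. by rewrite expq_q -cardF expf_card. Qed.

Definition bar u : galg F G := ([ffun g => coef u (- g) ^+ q] : {ffun G -> F^o}).

Lemma coef_bar u g : coef (bar u) g = coef u (- g) ^+ q.
Proof. by rewrite /coef ffunE. Qed.

Lemma pnu_gt0 : (0 < q)%N.
Proof. by rewrite expn_gt0 prime_gt0 // (pcharf_prime pcharF). Qed.

Lemma barD : {morph bar : u v / u + v}.
Proof.
by move=> u v; apply: galg_ext => g;
  rewrite Defs.coefD !coef_bar Defs.coefD (field_expD pcharF).
Qed.

Lemma bar0 : bar 0 = 0.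
Proof. by apply: (addrI (bar 0)); rewrite -barD !addr0. Qed.

Lemma barZ c u : bar (c *: u) = c ^+ q *: bar u.
Proof. by apply: galg_ext => g; rewrite Defs.coefZ !coef_bar Defs.coefZ exprMn. Qed.

Lemma barK : involutive bar.
Proof. by move=> u; apply: galg_ext => g; rewrite !coef_bar opprK field_expqK. Qed.

Lemma bar_monom g : bar (monom F g) = monom F (- g).
Proof.
apply: galg_ext => h; rewrite coef_bar !coef_monom -eqr_oppLR.
by case: eqP => _; rewrite ?expr1n // expr0n eqn0Ngt pnu_gt0.
Qed.

Lemma bar_sum (I : Type) (r : seq I) (P : pred I) (f : I -> galg F G) :
  bar (\sum_(i <- r | P i) f i) = \sum_(i <- r | P i) bar (f i).
Proof. exact: (big_morph _ barD bar0). Qed.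

Lemma barM : {morph bar : u v / u * v}.
Proof.
move=> u v; rewrite [u]galg_sumE [v]galg_sumE mulr_suml !bar_sum mulr_suml.
apply: eq_bigr => g _; rewrite !mulr_sumr bar_sum; apply: eq_bigr => h _.
rewrite -scalerAl -scalerAr scalerA monomM !barZ !bar_monom -scalerAl -scalerAr.
by rewrite scalerA monomM exprMn opprD.
Qed.

Lemma bar1 : bar 1 = 1.
Proof. by rewrite bar_monom oppr0. Qed.

Lemma barX u n : bar (u ^+ n) = bar u ^+ n.
Proof. by elim: n => [|n IHn]; [exact: bar1 | rewrite !exprS barM IHn]. Qed.

Lemma herm_bar u v : herm p nu u v = coef (u * bar v) 0.
Proof. by rewrite coef_mul; apply: eq_bigr => h _; rewrite coef_bar sub0r opprK. Qed.

(* Unlike [bar], its composite with the q-th power map is F-linear. *)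
Definition frob_bar u : galg F G := bar u ^+ q.

Lemma frob_barD : {morph frob_bar : u v / u + v}.
Proof. by move=> u v; rewrite /frob_bar barD (galg_expD pcharF). Qed.

Lemma frob_barM : {morph frob_bar : u v / u * v}.
Proof. by move=> u v; rewrite /frob_bar barM exprMn. Qed.

Lemma frob_barX u n : frob_bar (u ^+ n) = frob_bar u ^+ n.
Proof. by rewrite /frob_bar barX -!exprM mulnC. Qed.

Lemma frob_barZ c u : frob_bar (c *: u) = c *: frob_bar u.
Proof. by rewrite /frob_bar barZ exprZn field_expqK. Qed.

Lemma frob_bar_monom g : frob_bar (monom F g) = monom F (- (g *+ q)).
Proof. by rewrite /frob_bar bar_monom monomX mulNrn. Qed.

Lemma frob_bar2 u : frob_bar (frob_bar u) = u ^+ (p ^ (2 * nu)).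
Proof. by rewrite /frob_bar barX barK expq_q. Qed.

Lemma iter_frob_bar_double n u :
  iter (n.*2) frob_bar u = u ^+ ((p ^ (2 * nu)) ^ n).
Proof.
elim: n => [|n IHn]; first by rewrite expn0 expr1.
by rewrite doubleS /= IHn frob_bar2 -exprM expnSr.
Qed.

Lemma frob_bar_primidem (i : {e : galg F G | primidem e}) :
  frob_bar (val i) = bar (val i).
Proof. by rewrite /frob_bar -barX -(prednK pnu_gt0) primidem_pow. Qed.

(** Evaluating X^Q - X, the product of the X - c over c in F, at u gives 0, so some factor u - c
    vanishes on the component. *)
Lemma primidem_frobenius_fixed (i : {e : galg F G | primidem e}) u :
  val i * u = u -> u ^+ #|F| = u -> exists c : F, u = c *: val i.
Proof.
move=> eu uQ.
have : horner_alg u ('X^#|F| - 'X) = 0.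
  by rewrite rmorphB rmorphXn /= horner_algX uQ subrr.
rewrite finField_genPoly rmorph_prod /= => prod0.
have eF c : val i * horner_alg u ('X - c%:P) = u - c *: val i.
  by rewrite rmorphB /= horner_algX horner_algC mulrBr eu -scalerAr mulr1.
have [||| a /mapP[c _ ->]] := @primidem_prod_eq0 _ i #|F| [seq horner_alg u ('X - c%:P)
  | c : F].
- exact: finNzRing_gt1.
- move=> _ /mapP[c _ ->]; rewrite eF.
  have := galg_expD pcharF (2 * nu) (u - c *: val i) (c *: val i).
  rewrite -cardF subrK uQ exprZn expf_card -(prednK (ltnW (finNzRing_gt1 F))).
  by rewrite primidem_pow => {2}->; rewrite addrK.
- by rewrite big_map big_enum prod0 mulr0.
by rewrite eF => /eqP; rewrite subr_eq0 => /eqP ->; exists c.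
Qed.

(* [frob_bar u] is a root of the product of the [X - u^(Q^i)], with
   [Q = #|F|], because the coefficients of this product are fixed by the Q-th
   power map, hence in [F] on the component of [i], hence fixed by [frob_bar]. *)
Lemma frob_bar_selfdual (i : {e : galg F G | primidem e}) (h : nat) u :
  bar (val i) = val i -> val i * u = u -> u ^+ (#|F| ^ h.+1) = u ->
  exists n, frob_bar u = u ^+ (#|F| ^ n).
Proof.
move=> bari eu uM; set Q := #|F|; set e := val i.
have QD (v w : galg F G) : (v + w) ^+ Q = v ^+ Q + w ^+ Q.
  by rewrite /Q cardF (galg_expD pcharF).
have fb0 : frob_bar 0 = 0 by rewrite /frob_bar bar0 expr0n eqn0Ngt pnu_gt0.
pose f : {poly galg F G} := \prod_(j < h.+1) ('X - (u ^+ (Q ^ j))%:P).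
have PhiB : GRing.zmod_morphism (fun v : galg F G => v ^+ Q).
  by move=> v w /=; apply/eqP; rewrite eq_sym subr_eq -QD subrK.
have PhiM : GRing.monoid_morphism (fun v : galg F G => v ^+ Q).
  by split=> [|v w] /=; rewrite ?expr1n ?exprMn.
pose Phi : {rmorphism galg F G -> galg F G} :=
  HB.pack (fun v : galg F G => v ^+ Q)
    (GRing.isZmodMorphism.Build _ _ (fun v : galg F G => v ^+ Q) PhiB)
    (GRing.isMonoidMorphism.Build _ _ (fun v : galg F G => v ^+ Q) PhiM).
have fQ j : f`_j ^+ Q = f`_j.
  apply: (@coef_prod_orbit _ Phi (fun n => u ^+ (Q ^ n))) => [n|];
    first by rewrite /= -exprM -expnSr.
  by rewrite uM expn0 expr1.
have fF j : frob_bar (e * f`_j) = e * f`_j.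
  have [||c ->] := @primidem_frobenius_fixed i (e * f`_j).
  - by rewrite mulrA primidem_idem.
  - by rewrite exprMn fQ -(prednK (ltnW (finNzRing_gt1 F))) primidem_pow.
  by rewrite frob_barZ frob_bar_primidem bari.
(* The coefficients of e f are fixed by [frob_bar], so this value is the image of e f(u), and u is a
   root of f. *)
have eroot : e * f.[frob_bar u] = 0.
  have <- : frob_bar (e * f.[u]) = e * f.[frob_bar u].
    rewrite !horner_coef !mulr_sumr (big_morph _ frob_barD fb0).
    by apply: eq_bigr => j _; rewrite !mulrA frob_barM fF frob_barX.
  rewrite -fb0; congr frob_bar; rewrite /f horner_prod big_ord_recl hornerXsubC.
  by rewrite /= expn0 expr1 subrr mul0r mulr0.
have eX n : e * u ^+ (Q ^ n) = u ^+ (Q ^ n).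
  have Qn_gt0 : (0 < Q ^ n)%N by rewrite expn_gt0 (ltnW (finNzRing_gt1 F)).
  by rewrite -{1}[e](primidem_pow i (Q ^ n).-1) prednK // -exprMn eu.
have efu : e * frob_bar u = frob_bar u by rewrite -{2}eu frob_barM frob_bar_primidem bari.
have efX n : e * ('X - (u ^+ (Q ^ n))%:P).[frob_bar u] = frob_bar u - u ^+ (Q ^ n).
  by rewrite hornerXsubC mulrBr efu eX.
rewrite /f horner_prod in eroot.
have [||| a /mapP[j _ ->]] :=
  @primidem_prod_eq0 _ i (Q ^ h.+1) [seq ('X - (u ^+ (Q ^ j))%:P).[frob_bar u] | j :
    'I_h.+1].
- by rewrite -(exp1n h.+1) ltn_exp2r // finNzRing_gt1.
(* Both [frob_bar u] and the powers of u are fixed by the power Q^(h+1), hence so is their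
   difference. *)
- move=> _ /mapP[j _ ->]; rewrite efX.
  have := galg_expD pcharF (2 * nu * h.+1) (frob_bar u - u ^+ (Q ^ j)) (u ^+ (Q ^ j)).
  rewrite subrK expnM -cardF -frob_barX uM -exprM mulnC exprM uM.
  by move=> {2}->; rewrite addrK.
- by rewrite big_map big_enum.
by rewrite efX => /eqP; rewrite subr_eq0 => /eqP ->; exists j.
Qed.

End Bar.




(** * The nilpotent generator for a cyclic p-factor *)

Lemma zmod_card_mulrn (A : finZmodType) (a : A) : a *+ #|A| = 0.
Proof.
by have := @expg_cardG _ (setT_group A) a (in_setT a); rewrite cardsT zmodXgE => ->.
Qed.

Lemma zmod_mulrn_mod (A : finZmodType) (a : A) n n' :
  n = n' %[mod #|A|] -> a *+ n = a *+ n'.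
Proof.
move=> nn; rewrite (divn_eq n #|A|) (divn_eq n' #|A|) nn !mulrnDr.
by rewrite ![(_ * #|A|)%N]mulnC !mulrnA zmod_card_mulrn !mul0rn.
Qed.

Section CyclicFactor.
Variables (F : finFieldType) (A : finZmodType) (p k nu h : nat).
Hypothesis pcharF : p \in [pchar F].
Hypothesis cardF : #|F| = (p ^ (2 * nu))%N.
Hypothesis nu_gt0 : (0 < nu)%N.
Hypothesis kh : (k <= h)%N.
Hypothesis h_gt0 : (0 < h)%N.
Local Notation N := (p ^ k)%N.
Local Notation M := (#|F| ^ h)%N.
Hypothesis M_mod : M = 1 %[mod #|A|].
Local Notation G := (A * cyclicZ N)%type.
Implicit Types (u v : galg F G) (a : A) (z : cyclicZ N).

Lemma pk_gt0 : (0 < N)%N.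
Proof. by rewrite expn_gt0 prime_gt0 // (pcharf_prime pcharF). Qed.

Lemma card_expn_gt1 : (1 < M)%N.
Proof. by rewrite -(exp1n h) ltn_exp2r // finNzRing_gt1. Qed.

Lemma card_expnE : M = (p ^ (2 * nu * h))%N.
Proof. by rewrite cardF -expnM. Qed.

Lemma galg_expM_D u v : (u + v) ^+ M = u ^+ M + v ^+ M.
Proof. by rewrite card_expnE (galg_expD pcharF). Qed.

Lemma field_expM (c : F) : c ^+ M = c.
Proof. by elim: h => [|n IHn]; rewrite ?expr1 // expnS exprM expf_card. Qed.

Lemma card_cyclic_pk : #|cyclicZ N| = N.
Proof. exact: card_cyclicZ pk_gt0. Qed.

Lemma cyclic_mulrn_pk z : z *+ N = 0.
Proof. by have := zmod_card_mulrn z; rewrite card_cyclic_pk. Qed.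

Lemma cyclic_mulrn_expn z : z *+ M = 0.
Proof.
have -> : M = (N * p ^ (2 * nu * h - k))%N.
  by rewrite card_expnE -expnD subnKC // (leq_trans kh) // leq_pmull // muln_gt0.
by rewrite mulrnA cyclic_mulrn_pk mul0rn.
Qed.

Lemma group_mulrn_expn a : a *+ M = a.
Proof. by rewrite (zmod_mulrn_mod _ M_mod). Qed.

Lemma pair_addE a a' z z' : ((a, z) : G) + (a', z') = (a + a', z + z').
Proof. by []. Qed.

Lemma pair_subE a a' z z' : ((a, z) : G) - (a', z') = (a - a', z - z').
Proof. by []. Qed.

Lemma pair_mulrn a z n : ((a, z) : G) *+ n = (a *+ n, z *+ n).
Proof. by elim: n => // n IHn; rewrite !mulrS IHn. Qed.

(** Multiplication by M is the identity on A and zero on the cyclic factor, and the M-th power is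
    the identity on F. So the M-th power is the projection of the group algebra onto F[A]. *)
Lemma galg_expM u : u ^+ M = \sum_g coef u g *: monom F ((g.1, 0) : G).
Proof.
rewrite card_expnE (galg_exp pcharF) -card_expnE; apply: eq_bigr => -[a z] _.
by rewrite field_expM pair_mulrn group_mulrn_expn cyclic_mulrn_expn.
Qed.

Lemma coef_expM u a z : z != 0 -> coef (u ^+ M) (a, z) = 0.
Proof.
move=> z0; rewrite galg_expM galg_coef_sum big1 // => g _.
by rewrite Defs.coefZ coef_monom xpair_eqE (negPf z0) andbF mulr0.
Qed.

Lemma coef_residue u a z : u ^+ M = u -> z != 0 -> coef u (a, z) = 0.
Proof. by move=> <-; exact: coef_expM. Qed.

Lemma residue_coef u : (forall a z, z != 0 -> coef u (a, z) = 0) -> u ^+ M = u.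
Proof.
move=> u0; rewrite galg_expM {2}[u]galg_sumE; apply: eq_bigr => -[a z] _ /=.
by have [-> //|/u0->] := eqVneq z 0; rewrite !scale0r.
Qed.

Lemma galg_expMK u : (u ^+ M) ^+ M = u ^+ M.
Proof. by apply: residue_coef => a z; exact: coef_expM. Qed.

Definition cyc_gen : cyclicZ N := (inZp 1 : 'I_N.-1.+1).

Lemma cyc_genX n : cyc_gen *+ n = (inZp n : 'I_N.-1.+1).
Proof. by rewrite Zp_mulrn; apply: val_inj; rewrite /= modnMml mul1n. Qed.

Lemma cyc_genE z : z = cyc_gen *+ (z : 'I_N.-1.+1).
Proof. by rewrite cyc_genX valZpK. Qed.

(** For k = 0 the generator is 0 and y = 0, with y^(N-1) = 1; the lemmas below include this case. *)
Definition nil_gen : galg F G := monom F (0, cyc_gen) - 1.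
Local Notation y := nil_gen.

(** Termwise, Y^(a,z) - Y^(a,0) is Y^(a,0) times g^z - 1 with g = y + 1, and the witness is the
    geometric sum of g. *)
Lemma subr_expM_dvd u : exists w, u - u ^+ M = y * w.
Proof.
exists (\sum_g coef u g *: (monom F ((g.1, 0) : G) *
          \sum_(i < (g.2 : 'I_N.-1.+1)) monom F ((0, cyc_gen) : G) ^+ i)).
rewrite galg_expM {1}[u]galg_sumE -sumrB mulr_sumr; apply: eq_bigr => -[a z] _ /=.
rewrite -scalerBr -scalerAr mulrCA -subrX1 mulrBr mulr1 monomX monomM.
by rewrite pair_mulrn mul0rn -cyc_genE pair_addE addr0 add0r.
Qed.

Lemma nil_genN : y ^+ N = 0.
Proof.
have := galg_expD pcharF k y 1; rewrite subrK monomX expr1n pair_mulrn.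
by rewrite cyclic_mulrn_pk mul0rn => E; apply: (addIr 1); rewrite add0r -E.
Qed.

(** Since u is supported on A x 0, in the binomial expansion of (g - 1)^(N-1) u only the leading
    term g^(N-1) u reaches the position (a, N-1), and its coefficient there is that of u at (a,
    0). *)
Lemma nil_gen_free u : u ^+ M = u -> y ^+ N.-1 * u = 0 -> u = 0.
Proof.
move=> uM yu; apply: galg_ext => -[a z].
have -> : coef 0 (a, z) = 0 :> F by rewrite /coef ffunE.
have [->|/(coef_residue _ uM) //] := eqVneq z 0.
have := congr1 (fun u => coef u (a, cyc_gen *+ N.-1)) yu.
rewrite {2}/coef ffunE exprBn mulr_suml galg_coef_sum => <-.
rewrite (bigD1 ord0) //= big1 ?addr0.
  rewrite subn0 bin0 mul1r mulr1 mulr1n monomX coef_monomM pair_mulrn mul0rn.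
  by rewrite pair_subE subr0 subrr.
move=> i i0; rewrite expr1n mulr1 -mulrnAl -mulrA monomX pair_mulrn mul0rn.
set c := _ *+ _; have -> : c = GRing.in_alg (galg F G) ((-1) ^+ i *+ 'C(N.-1, i)).
  by rewrite rmorphMn rmorphXn rmorphN1.
rewrite in_algE -scalerAl mul1r Defs.coefZ coef_monomM pair_subE subr0.
have iN : (i <= N.-1)%N by rewrite -ltnS.
rewrite -mulrnBr ?leq_subr // subKn // coef_residue ?mulr0 //.
rewrite cyc_genX; apply: contra i0 => /eqP/(congr1 val) /=.
by rewrite modn_small // => i0; apply/eqP/val_inj.
Qed.

(** That is, g^-1 - 1 = - g^-1 (g - 1): conjugation changes y by a unit and so preserves the
    filtration by powers of y. *)
Lemma bar_nil_gen : bar p nu y = - monom F ((0, - cyc_gen) : G) * y.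
Proof.
apply: (addIr (bar p nu 1)); rewrite -(barD nu pcharF) subrK (bar1 _ nu pcharF).
rewrite (bar_monom nu pcharF) mulNr mulrBr mulr1 monomM pair_addE addr0 addNr.
rewrite -[monom F (0, 0)]/(1 : galg F G) opprB subrK.
by congr monom; congr pair; rewrite ?oppr0.
Qed.

Lemma dvdy_bar n u : dvdy y n u -> dvdy y n (bar p nu u).
Proof.
move=> /dvdyP[w ->]; apply/dvdyP; rewrite (barM nu pcharF) (barX nu pcharF) bar_nil_gen.
rewrite exprMn -mulrA mulrCA.
by exists ((- monom F ((0, - cyc_gen) : G)) ^+ n * bar p nu w).
Qed.


End CyclicFactor.





(** * Self-conjugate components *)

Section SelfDual.
Variables (F : finFieldType) (A : finZmodType) (p k nu h : nat).
Hypothesis pcharF : p \in [pchar F].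
Hypothesis cardF : #|F| = (p ^ (2 * nu))%N.
Hypothesis nu_gt0 : (0 < nu)%N.
Hypothesis kh : (k <= h)%N.
Hypothesis h_gt0 : (0 < h)%N.
Local Notation N := (p ^ k)%N.
Local Notation M := (#|F| ^ h)%N.
Hypothesis M_mod : M = 1 %[mod #|A|].
Local Notation G := (A * cyclicZ N)%type.
Local Notation R := (galg F G).
Local Notation I := {e : R | primidem e}.
Implicit Types (u v : R) (a : A) (z : cyclicZ N) (i : I).

Definition bar_primidem i : I :=
  Sub (bar p nu (val i))
    (primidem_rmorph (bar0 G nu pcharF) (barM nu pcharF) (barK cardF) (valP i)).

Lemma bar_primidemK : involutive bar_primidem.
Proof. by move=> i; apply: val_inj; rewrite /= (barK cardF). Qed.

Local Notation tau := (@frob_bar F G p nu).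
Local Notation j := (h.*2`_2^')%N.
(** As j is odd, T still moves primitive idempotents as [bar] does; as j is the odd part of the
    period 2h, T fixes each point having period 2h and also an odd period under [tau]. *)
Definition frob_bar_odd u : R := iter j tau u.
Local Notation T := frob_bar_odd.

Lemma odd_part_odd : odd j.
Proof. by rewrite odd_2'nat part_pnat. Qed.

Lemma frob_bar_oddD : {morph T : u v / u + v}.
Proof. by move=> u v; rewrite /T; elim: j => //= n ->; rewrite (frob_barD _ pcharF). Qed.

Lemma frob_bar_oddM : {morph T : u v / u * v}.
Proof. by move=> u v; rewrite /T; elim: j => //= n ->; rewrite (frob_barM _ pcharF). Qed.

Lemma frob_bar_oddZ c u : T (c *: u) = c *: T u.
Proof. by rewrite /T; elim: j => //= n ->; rewrite (frob_barZ cardF). Qed.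

Lemma frob_bar_oddX u n : T (u ^+ n) = T u ^+ n.
Proof. by rewrite /T; elim: j => //= l ->; rewrite (frob_barX _ pcharF). Qed.

Lemma frob_bar_odd0 : T 0 = 0.
Proof. by apply: (addrI (T 0)); rewrite -frob_bar_oddD !addr0. Qed.

Lemma frob_bar_odd_sum (J : Type) (r : seq J) (P : pred J) (f : J -> R) :
  T (\sum_(i <- r | P i) f i) = \sum_(i <- r | P i) T (f i).
Proof. exact: (big_morph _ frob_bar_oddD frob_bar_odd0). Qed.

Lemma frob_bar_period u : u ^+ M = u -> iter h.*2 tau u = u.
Proof. by move=> uM; rewrite (iter_frob_bar_double pcharF cardF) -cardF. Qed.

Lemma frob_bar_odd_primidem i : T (val i) = val (bar_primidem i).
Proof.
have bb n : iter n tau (val i) = val (if odd n then bar_primidem i else i).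
  elim: n => //= n ->; rewrite (frob_bar_primidem nu pcharF); case: (odd n) => //=.
  by rewrite (barK cardF).
by rewrite /T bb odd_part_odd.
Qed.

(* [None] marks the self-conjugate components; [Some] tells apart the two
   members of every other conjugate pair. *)
Definition color i : option bool :=
  if bar_primidem i == i then None
  else Some (enum_rank i < enum_rank (bar_primidem i))%N.

Lemma color_bar i : color (bar_primidem i) = omap negb (color i).
Proof.
rewrite /color bar_primidemK eq_sym; case: eqP => //= /eqP neq.
case: ltngtP => // /ord_inj/enum_rank_inj ii.
by rewrite ii eqxx in neq.
Qed.

Definition color_idem (k : option bool) : R := \sum_(i | color i == k) val i.

Lemma color_idem_mul i c :
  val i * color_idem c = if color i == c then val i else 0.
Proof.
rewrite mulr_sumr; case: ifPn => [ci|nci].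
  rewrite (bigD1 i) //= primidem_idem big1 ?addr0 // => l /andP[_ li].
  by rewrite primidem_orth // eq_sym.
rewrite big1 // => l cl; rewrite primidem_orth //.
by apply: contra nci => /eqP ->.
Qed.

Lemma residueD u v : u ^+ M = u -> v ^+ M = v -> (u + v) ^+ M = u + v.
Proof. by move=> uM vM; rewrite (galg_expM_D h pcharF cardF) uM vM. Qed.

Lemma residue0 : (0 : R) ^+ M = 0.
Proof. by rewrite expr0n eqn0Ngt (ltnW (card_expn_gt1 F h_gt0)). Qed.

(** First use of [card_fixed_swap], with the components grouped by [color]: the part U is the sum of
    the residue fields of the self-conjugate components. *)
Lemma card_fixed_frob_bar_ideals :
  (#|[set u : R | (u ^+ M == u) && (T u == u)]| ^ 2 =
   (\prod_(i | bar_primidem i == i) #|residue M i|) *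
   #|[set u : R | (u ^+ M == u) && (T (T u) == u)]|)%N.
Proof.
pose X := [set u : R | u ^+ M == u].
have XE (Q : pred R) : #|[set u : R | (u ^+ M == u) && Q u]| = #|[set u in X | Q u]|.
  by apply: eq_card => u; rewrite !inE.
have idemM c : color_idem c ^+ M = color_idem c.
  by rewrite (big_morph _ (galg_expM_D h pcharF cardF) residue0); apply: eq_bigr => i _;
    rewrite (primidem_powM (card_expn_gt1 F h_gt0)).
have XP u : u \in X -> u ^+ M = u by rewrite inE => /eqP.
have mulX v u : v ^+ M = v -> u \in X -> v * u \in X.
  by move=> vM /XP uM; rewrite inE exprMn vM uM.
rewrite !XE (@card_fixed_swap _ X T (fun c u => color_idem c * u)); first congr (_ * _)%N.
- pose B i := if bar_primidem i == i then residue M i else [set 0].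
  have BE i u : u \in B i -> val i * u = u.
    rewrite /B; case: ifP => _; first by rewrite inE => /andP[/eqP].
    by move/set1P->; rewrite mulr0.
  transitivity (\prod_i #|B i|)%N; last first.
    by rewrite [RHS]big_mkcond /=; apply: eq_bigr => i _; rewrite /B; case: ifP;
      rewrite ?cards1.
  rewrite -card_primidem_components //; apply: eq_card => u; rewrite !inE.
  apply/andP/forallP => [[uX /eqP uE] i|uB].
    rewrite /B -uE mulrA color_idem_mul /color; case: (bar_primidem i == i) => /=;
      last by rewrite mul0r set11.
    rewrite inE mulrA primidem_idem eqxx /=.
    by rewrite exprMn (primidem_powM (card_expn_gt1 F h_gt0)) (eqP uX).
  split.
    rewrite [u]primidem_split.
    rewrite (big_morph _ (galg_expM_D h pcharF cardF) residue0); apply/eqP/eq_bigr => i _.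
    have := uB i; rewrite /B; case: ifP => _; first by rewrite inE => /andP[_ /eqP].
    by move/set1P->; rewrite residue0.
  rewrite {2}[u]primidem_split {1}[u]primidem_split mulr_sumr; apply/eqP/eq_bigr => i _.
  rewrite mulrA [_ * val i]mulrC color_idem_mul /color.
  have := uB i; rewrite /B; case: ifP => //= _ /set1P->; by rewrite mul0r.
- by move=> u v /XP uM /XP vM; rewrite inE residueD.
- by move=> u /XP uM; rewrite inE -frob_bar_oddX uM.
- by move=> c u; exact: mulX.
- exact: frob_bar_oddD.
- by move=> c u v; rewrite mulrDr.
- move=> c l u; rewrite mulrA; case: eqP => [<-|/eqP cl].
    rewrite {2}/color_idem mulr_sumr; congr (_ * u); apply: eq_bigr => i ic.
    by rewrite mulrC color_idem_mul ic.
  rewrite {2}/color_idem mulr_sumr big1 ?mul0r // => i /eqP il.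
  by rewrite mulrC color_idem_mul il eq_sym (negPf cl).
- move=> u _; rewrite -!mulrDl -[LHS]mul1r; congr (_ * u).
  by rewrite -sum_option_bool -(primidem_sum R) (partition_big color xpredT).
- move=> c u; rewrite frob_bar_oddM; congr (_ * _).
  rewrite /color_idem frob_bar_odd_sum [RHS](reindex_inj (inv_inj bar_primidemK)) /=.
  apply: eq_big => [i|i _]; last exact: frob_bar_odd_primidem.
  by rewrite color_bar; case: (color i) c => [[]|] [[]|].
move=> u /XP uM; rewrite /color_idem mulr_suml frob_bar_odd_sum; apply: eq_bigr => i.
rewrite /color; case: (bar_primidem i =P i) => // ii _; rewrite /T.
have vM : (val i * u) ^+ M = val i * u.
  by rewrite exprMn uM (primidem_powM (card_expn_gt1 F h_gt0)).
(* On a self-conjugate component, tau agrees at the given point with an even iterate of itself,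
   which produces an odd period. *)
have [|||n fn] := @frob_bar_selfdual F G p nu pcharF cardF i h.-1 (val i * u).
- by rewrite -{2}ii.
- by rewrite mulrA primidem_idem.
- by rewrite prednK.
apply: (@iter_odd_period _ _ _ n) => //; first exact: frob_bar_period.
by rewrite (iter_frob_bar_double pcharF cardF) -cardF fn.
Qed.

(** The action of [frob_bar] on the exponents of monomials, needed both on A and on the whole
    group. *)
Definition neg_q (B : finZmodType) (a : B) : B := - (a *+ (p ^ nu)).

Local Notation Q := (p ^ (2 * nu))%N.
Local Notation cls := (cyclotomic_class Q).

Lemma iter_neg_q_double a n : iter n.*2 (@neg_q A) a = a *+ (Q ^ n).
Proof.
elim: n => [|n IHn]; first by rewrite expn0.
rewrite doubleS /= IHn /neg_q mulNrn opprK -!mulrnA -expnD addnn -mul2n.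
by rewrite expnSr.
Qed.

Lemma neg_q_period a : iter h.*2 (@neg_q A) a = a.
Proof. by rewrite iter_neg_q_double -cardF (group_mulrn_expn M_mod). Qed.

Lemma mem_cyclotomic_class a : a \in cls a.
Proof. by apply/cyclotomic_classP; exists 0%N; rewrite expn0. Qed.

Lemma cyclotomic_class_eq a b : b \in cls a -> cls b = cls a.
Proof.
have sub a' b' : b' \in cls a' -> cls b' \subset cls a'.
  move=> /cyclotomic_classP[n ->]; apply/subsetP => _ /cyclotomic_classP[l ->].
  by apply/cyclotomic_classP; exists (n + l)%N; rewrite -mulrnA expnD.
move=> ba; apply/eqP; rewrite eqEsubset !sub //.
(* Multiplication by Q^h is the identity on A, so Q^(hn - n) undoes Q^n. *)
case/cyclotomic_classP: ba => n ->; apply/cyclotomic_classP; exists (h * n - n)%N.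
rewrite -mulrnA -expnD subnKC ?leq_pmull // expnM -cardF.
by elim: n => // n IHn; rewrite expnS mulrnA (group_mulrn_expn M_mod).
Qed.

Lemma mem_herm_R a : (a \in herm_R A p nu) = (cls (neg_q a) == cls a).
Proof.
rewrite inE; apply/idP/eqP => [|<-]; last exact: mem_cyclotomic_class.
exact: cyclotomic_class_eq.
Qed.

Lemma cls_neg_q2 a : cls (neg_q (neg_q a)) = cls a.
Proof.
apply: cyclotomic_class_eq; apply/cyclotomic_classP; exists 1%N.
by rewrite -iter_neg_q_double.
Qed.

(** The analogue of [color] for group elements. Whole classes are ranked, so [None] marks the
    elements of [herm_R] and [neg_q] exchanges the other two colours. *)
Definition class_color a : option bool :=
  if cls (neg_q a) == cls a then None
  else Some (enum_rank (cls a) < enum_rank (cls (neg_q a)))%N.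

Lemma class_color_None a : (class_color a == None) = (a \in herm_R A p nu).
Proof. by rewrite mem_herm_R /class_color; case: ifP. Qed.

Lemma class_color_neg_q a : class_color (neg_q a) = omap negb (class_color a).
Proof.
rewrite /class_color cls_neg_q2 eq_sym; case: eqP => //= /eqP neq.
congr Some; rewrite -leqNgt.
case: ltngtP => // /ord_inj aa.
by rewrite (enum_rank_inj aa) eqxx in neq.
Qed.

Lemma class_color_iter a n :
  class_color (iter n (@neg_q A) a) = if odd n then omap negb (class_color a) else
    class_color a.
Proof.
elim: n => //= n IHn; rewrite class_color_neg_q IHn.
by case: (odd n); case: (class_color a) => [[]|].
Qed.

Definition odd_index (g : G) : G := iter j (@neg_q G) g.

Lemma frob_bar_odd_monom g : T (monom F g) = monom F (odd_index g).
Proof.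
rewrite /T /odd_index; elim: j => //= n ->.
by rewrite (frob_bar_monom _ pcharF).
Qed.

Lemma odd_index1 g : (odd_index g).1 = iter j (@neg_q A) g.1.
Proof.
rewrite /odd_index; elim: j => //= n <-; case: (iter _ _ _) => a z.
by rewrite /neg_q pair_mulrn.
Qed.

Lemma odd_index2 a : (odd_index (a, 0)).2 = 0.
Proof.
rewrite /odd_index; elim: j => //= n; case: (iter _ _ _) => b z /= ->.
by rewrite /neg_q pair_mulrn mul0rn /= oppr0.
Qed.

Definition color_part (c : option bool) u : R :=
  \sum_(g | class_color g.1 == c) coef u g *: monom F g.

Lemma coef_color_part c u g :
  coef (color_part c u) g = if class_color g.1 == c then coef u g else 0.
Proof.
rewrite galg_coef_sum; case: ifPn => [gc|gc].
  rewrite (bigD1 g) //= Defs.coefZ coef_monom eqxx mulr1 big1 ?addr0 //.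
  by move=> l /andP[_ lg]; rewrite Defs.coefZ coef_monom eq_sym (negPf lg) mulr0.
rewrite big1 // => l lc; rewrite Defs.coefZ coef_monom.
by case: eqP => [gl|]; rewrite ?mulr0 //; rewrite gl lc in gc.
Qed.

Lemma color_partD c : {morph color_part c : u v / u + v}.
Proof.
move=> u v; apply: galg_ext => g; rewrite Defs.coefD !coef_color_part Defs.coefD.
by case: ifP; rewrite ?addr0.
Qed.

Lemma color_part_monomZ c x g : color_part c (x *: monom F g) =
  if class_color g.1 == c then x *: monom F g else 0.
Proof.
apply: galg_ext => l; rewrite coef_color_part Defs.coefZ coef_monom.
have coef0 : coef 0 l = 0 :> F by rewrite /coef ffunE.
have [->|lg] := eqVneq l g.
  by case: ifP; rewrite ?Defs.coefZ ?coef_monom ?eqxx // /coef ffunE.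
by rewrite mulr0 if_same; case: ifP;
  rewrite ?coef0 // Defs.coefZ coef_monom (negPf lg) mulr0.
Qed.

Lemma frob_bar_odd_color_part c u : T (color_part c u) = color_part (omap negb c) (T u).
Proof.
have part0 d : color_part d 0 = 0 by apply: (addrI (color_part d 0));
  rewrite -color_partD !addr0.
rewrite [in RHS](galg_sumE u) !frob_bar_odd_sum (big_morph _ (color_partD _) (part0 _)).
rewrite big_mkcond; apply: eq_bigr => g _.
rewrite !frob_bar_oddZ !frob_bar_odd_monom color_part_monomZ odd_index1
  class_color_iter odd_part_odd.
by case: (class_color g.1) c => [[]|] [[]|].
Qed.

(** Here -q a = Q^n a for some n, so one step of [neg_q] equals 2n steps and a has an odd period. *)
Lemma class_color_fixed a : class_color a = None -> iter j (@neg_q A) a = a.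
Proof.
rewrite /class_color; case: ifP => // /eqP aa _.
have := mem_cyclotomic_class (neg_q a); rewrite aa => /cyclotomic_classP[n an].
by apply: (iter_odd_period (n := n)); rewrite ?neg_q_period ?iter_neg_q_double.
Qed.

(** Second use of [card_fixed_swap], for the same T, with the monomial basis grouped by
    [class_color]: now U consists of the elements supported on [herm_R] x 0. *)
Lemma card_fixed_frob_bar_group :
  (#|[set u : R | (u ^+ M == u) && (T u == u)]| ^ 2 =
   #|F| ^ #|herm_R A p nu| *
   #|[set u : R | (u ^+ M == u) && (T (T u) == u)]|)%N.
Proof.
pose X := [set u : R | u ^+ M == u].
have XE (P : pred R) : #|[set u : R | (u ^+ M == u) && P u]| = #|[set u in X | P u]|.
  by apply: eq_card => u; rewrite !inE.
have XP u : u \in X -> u ^+ M = u by rewrite inE => /eqP.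
have X0 u a z : u \in X -> z != 0 -> coef u (a, z) = 0.
  by move=> /XP uM; apply: (coef_residue pcharF cardF nu_gt0 kh M_mod).
have inX u : (forall a z, z != 0 -> coef u (a, z) = 0) -> u \in X.
  by move=> u0; rewrite inE (residue_coef pcharF cardF nu_gt0 kh M_mod).
rewrite !XE (@card_fixed_swap _ X T color_part); first congr (_ * _)%N.
- pose D := [set g : G | (g.1 \in herm_R A p nu) && (g.2 == 0)].
  transitivity (#|F| ^ #|D|)%N; last first.
    congr (_ ^ _)%N; rewrite -(card_imset (herm_R A p nu) (f := fun a => (a, 0) : G)).
      apply: eq_card => -[a z]; rewrite inE /=;
        apply/andP/imsetP => [[aR /eqP->]|[b bR [-> ->]]].
        by exists a.
      by rewrite eqxx.
    by move=> a b [].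
  rewrite -(card_pffun_on (0 : F) (mem D) (mem F)); apply: eq_card => u.
  rewrite [in LHS]inE; apply/andP/pffun_onP => [[uX /eqP uE]|[/subsetP sup _]].
    split=> //; apply/subsetP => -[a z]; rewrite inE /= -/(coef u (a, z)) => nz.
    rewrite [_ \in _](_ : _ = (a \in herm_R A p nu) && (z == 0)); last by rewrite inE.
    have [z0|z0] := eqVneq z 0; last by case/eqP: nz; exact: X0.
    move: nz; rewrite andbT -uE coef_color_part class_color_None /=.
    by case: ifP => //; rewrite eqxx.
  have u0 g : g \notin D -> coef u g = 0.
    by move=> gD; apply/eqP; apply: contraR gD => nz; apply: sup.
  split; first by apply: inX => a z z0; apply: u0; rewrite inE /= (negPf z0) andbF.
  apply/eqP/galg_ext => g; rewrite coef_color_part; case: ifPn => // gc.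
  by rewrite u0 // inE negb_and -class_color_None gc.
- by move=> u v /XP uM /XP vM; rewrite inE residueD.
- by move=> u /XP uM; rewrite inE -frob_bar_oddX uM.
- move=> c u uX; apply: inX => a z z0; rewrite coef_color_part (X0 u) //.
  by case: ifP.
- exact: frob_bar_oddD.
- exact: color_partD.
- move=> c l u; apply: galg_ext => g; rewrite coef_color_part.
  have [<-|cl] := eqVneq c l; first by rewrite coef_color_part; case: (_ == c).
  rewrite coef_color_part [RHS]/coef ffunE.
  by case: (class_color _ =P c) => // ->; rewrite (negPf cl).
- move=> u _; apply: galg_ext => g; rewrite !Defs.coefD !coef_color_part.
  by case: (class_color _) => [[]|] /=; rewrite ?addr0 ?add0r.
- exact: frob_bar_odd_color_part.
move=> u uX; rewrite /color_part frob_bar_odd_sum; apply: eq_bigr => -[a z] /eqP /= ac.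
rewrite frob_bar_oddZ frob_bar_odd_monom; have [->|z0] := eqVneq z 0;
  last by rewrite (X0 u) // !scale0r.
congr (_ *: monom F _); rewrite [odd_index _]surjective_pairing odd_index2.
by rewrite odd_index1 class_color_fixed.
Qed.

(** Both counts share the number of fixed points of T^2, which is positive because 0 is one of
    them. *)
Lemma prod_selfdual_residue :
  (\prod_(i | bar_primidem i == i) #|residue M i| = #|F| ^ #|herm_R A p nu|)%N.
Proof.
have := card_fixed_frob_bar_ideals; rewrite card_fixed_frob_bar_group => /eqP.
rewrite eqn_pmul2r; first by move/eqP.
by apply/card_gt0P; exists 0; rewrite inE residue0 !frob_bar_odd0 !eqxx.
Qed.

End SelfDual.






(** * Codes, duals and hulls *)

Lemma code_dim_card (F : finFieldType) (H : finZmodType) (C : {set galg F H}) :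
  0 \in C -> (forall u v, u \in C -> v \in C -> u + v \in C) ->
  (forall (c : F) u, u \in C -> c *: u \in C) -> #|C| = (#|F| ^ code_dim C)%N.
Proof.
move=> C0 CD CZ; rewrite -card_vspace; apply: eq_card => u.
apply/idP/idP => [uC|uC]; first by rewrite memv_span // mem_enum.
rewrite (coord_span (X := in_tuple (enum C)) uC).
apply: (big_ind (fun v => v \in C)) => // j _; apply: CZ.
by rewrite -mem_enum mem_nth.
Qed.

Lemma is_idealP (F : finFieldType) (H : finZmodType) (C : {set galg F H}) :
  reflect [/\ 0 \in C, forall u v, u \in C -> v \in C -> u + v \in C &
              forall a u, u \in C -> a * u \in C] (is_ideal C).
Proof.
apply: (iffP and3P) => -[C0 CD CM]; split=> //.
- by move=> u v uC vC; have /forall_inP/(_ u uC)/forall_inP/(_ v vC) := CD.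
- by move=> a u uC; have /forallP/(_ a)/forall_inP/(_ u uC) := CM.
- by apply/forall_inP => u uC; apply/forall_inP => v; exact: CD.
- by apply/forallP => a; apply/forall_inP => u; exact: CM.
Qed.

Section Codes.
Variables (F : finFieldType) (A : finZmodType) (p k nu h : nat).
Hypothesis pcharF : p \in [pchar F].
Hypothesis cardF : #|F| = (p ^ (2 * nu))%N.
Hypothesis nu_gt0 : (0 < nu)%N.
Hypothesis kh : (k <= h)%N.
Hypothesis h_gt0 : (0 < h)%N.
Local Notation N := (p ^ k)%N.
Local Notation M := (#|F| ^ h)%N.
Hypothesis M_mod : M = 1 %[mod #|A|].
Local Notation G := (A * cyclicZ N)%type.
Local Notation R := (galg F G).
Local Notation I := {e : R | primidem e}.
Local Notation y := (nil_gen F A p k).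
Local Notation bari := (bar_primidem pcharF cardF).
Implicit Types (u v : R) (i : I) (n : {ffun I -> 'I_N.+1}).


Lemma abelian_codesE : abelian_codes F G = [set code_of y n | n : {ffun I -> 'I_N.+1}].
Proof.
apply/setP => C; rewrite inE; apply/is_idealP/imsetP => [[C0 CD CM]|[n _ ->]].
  have [n ->] := ideal_code_of (card_expn_gt1 F h_gt0) (galg_expMK pcharF cardF nu_gt0
    kh M_mod)
    (subr_expM_dvd pcharF cardF nu_gt0 kh M_mod) (nil_genN A k pcharF) C0 CD CM.
  by exists n.
exact: code_of_ideal.
Qed.

Lemma code_inj : injective (@code_of R y N).
Proof.
exact: (code_of_inj (pk_gt0 k pcharF) (card_expn_gt1 F h_gt0) (nil_genN A k pcharF)
  (nil_gen_free pcharF cardF nu_gt0 kh M_mod)).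
Qed.

(** As the code is an ideal, v is in the dual exactly when [bar v] annihilates the code. On
    component i this puts [bar v] at level N - n_i, and conjugating back moves the condition to the
    conjugate component. [rev_ord] is the reflection a -> N - a. *)
Lemma herm_dual_code n : herm_dual p nu (code_of y n) =
  code_of y [ffun i => rev_ord (n (bari i))].
Proof.
have annE i v : [forall c in code_of y n, c * (val i * bar p nu v) == 0] =
    dvdy y (rev_ord (n i)) (val i * bar p nu v).
  rewrite /= subSS -(annihilator_component (pk_gt0 k pcharF) (card_expn_gt1 F h_gt0)
    (galg_expMK pcharF cardF nu_gt0 kh M_mod) (subr_expM_dvd pcharF cardF nu_gt0 kh M_mod)
    (nil_genN A k pcharF) (nil_gen_free pcharF cardF nu_gt0 kh M_mod)) ?leq_ord //.
  apply/forall_inP/idP => [ann|/eqP ann c /code_ofP/(_ i)/dvdyP[z cE]].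
    rewrite -(primidem_idem i) -mulrA mulrA; apply: ann.
    by rewrite (ypow_primidem_in_code (pk_gt0 k pcharF) (card_expn_gt1 F h_gt0)
      (nil_genN A k pcharF)
      (nil_gen_free pcharF cardF nu_gt0 kh M_mod)) ?leq_ord.
  have -> : c * (val i * bar p nu v) = val i * c * (val i * bar p nu v).
    by rewrite mulrACA primidem_idem mulrCA.
  by rewrite cE mulrAC ann mul0r.
have dvdy_barE d v : dvdy y d (bar p nu v) = dvdy y d v.
  by apply/idP/idP => /(dvdy_bar nu pcharF) //; rewrite (barK cardF).
apply/setP => v; rewrite inE; apply/forall_inP/code_ofP => [dual i|vP c cC].
  rewrite ffunE -dvdy_barE (barM nu pcharF) -[bar p nu (val i)]/(val (bari i)) -annE.
  apply/forall_inP => c cC; apply/eqP/galg_ext => g.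
  have [_ _ CM] := code_of_ideal y n.
  (* The form sees only the coefficient at 0; translating by [monom F (- g)] stays in the code and
     brings the coefficient at g there. *)
  have := dual _ (CM (monom F (- g)) _ (CM (val (bari i)) _ cC)).
  rewrite (herm_bar p nu) -!mulrA coef_monomM sub0r opprK mulrCA => /eqP ->.
  by rewrite /coef ffunE.
rewrite (herm_bar p nu).
suff -> : c * bar p nu v = 0 by rewrite /coef ffunE.
rewrite [bar p nu v]primidem_split mulr_sumr big1 // => i _.
have := vP (bari i); rewrite ffunE (bar_primidemK pcharF cardF) -dvdy_barE.
rewrite (barM nu pcharF) [bar _ _ (val _)](_ : _ = val i); last by rewrite /= (barK cardF).
by rewrite -annE => /forall_inP/(_ c cC)/eqP.
Qed.

Definition hull_level n : {ffun I -> 'I_N.+1} :=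
  [ffun i => inord (maxn (n i) (N - n (bari i)))].

Lemma hull_levelE n i : hull_level n i = maxn (n i) (N - n (bari i)) :> nat.
Proof. by rewrite ffunE inordK // ltnS geq_max leq_ord leq_subr. Qed.

Lemma herm_hull_code n : herm_hull p nu (code_of y n) = code_of y (hull_level n).
Proof.
rewrite /herm_hull herm_dual_code; apply/setP => v; rewrite inE.
apply/andP/code_ofP => [[/code_ofP c1 /code_ofP c2] i|c].
  by rewrite hull_levelE dvdy_max c1; have := c2 i; rewrite ffunE /= subSS.
split; apply/code_ofP => i; have := c i; rewrite hull_levelE dvdy_max => /andP[] //.
by rewrite ffunE /= subSS.
Qed.

Definition residue_dim i : nat := code_dim (residue M i).

Lemma card_residue i : #|residue M i| = (#|F| ^ residue_dim i)%N.
Proof.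
have M_gt0 := ltnW (card_expn_gt1 F h_gt0).
apply: code_dim_card => [|u v|c u]; rewrite !inE.
- by rewrite mulr0 expr0n eqn0Ngt M_gt0 !eqxx.
- move=> /andP[/eqP eu /eqP uM] /andP[/eqP ev /eqP vM].
  by rewrite mulrDr eu ev eqxx (residueD pcharF cardF) ?eqxx.
move=> /andP[/eqP eu /eqP uM].
by rewrite -scalerAr eu exprZn uM field_expM !eqxx.
Qed.

Lemma card_code n :
  #|code_of y n| = (#|F| ^ \sum_i residue_dim i * (N - n i))%N.
Proof.
rewrite (card_code_of (card_expn_gt1 F h_gt0) (galg_expM_D h pcharF cardF)
  (galg_expMK pcharF cardF nu_gt0 kh M_mod) (subr_expM_dvd pcharF cardF nu_gt0 kh M_mod)
  (nil_genN A k pcharF) (nil_gen_free pcharF cardF nu_gt0 kh M_mod)).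
rewrite expn_sum; apply: eq_bigr => i _.
by rewrite card_residue -expnM.
Qed.

Lemma expn_card_inj : injective (expn #|F|).
Proof. by move=> a b /eqP; rewrite eqn_exp2l ?finNzRing_gt1 // => /eqP. Qed.

Lemma code_dim_code n :
  code_dim (code_of y n) = (\sum_i residue_dim i * (N - n i))%N.
Proof.
apply: expn_card_inj; rewrite -card_code code_dim_card //;
  have [C0 CD CM] := code_of_ideal y n.
- exact: C0.
- exact: CD.
by move=> c u uC; rewrite -[u]mul1r -[1 * u]/(1 * u : R) scalerAl; apply: CM.
Qed.

Lemma code_dim_hull n : code_dim (herm_hull p nu (code_of y n)) =
  (\sum_i residue_dim i * (N - maxn (n i) (N - n (bari i))))%N.
Proof.
rewrite herm_hull_code code_dim_code; apply: eq_bigr => i _.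
by rewrite hull_levelE.
Qed.

(** The zero exponents give the whole group algebra, whose cardinality is then counted in two
    ways. *)
Lemma sum_residue_dim : (\sum_i residue_dim i = #|A|)%N.
Proof.
apply/eqP; rewrite -(eqn_pmul2r (pk_gt0 k pcharF)); apply/eqP/expn_card_inj.
have := card_code [ffun=> ord0]; under eq_bigr do rewrite ffunE subn0.
rewrite -big_distrl /= => <-.
have -> : code_of y ([ffun=> ord0] : {ffun I -> 'I_N.+1}) = [set: R].
  by apply/setP => u; rewrite in_setT; apply/code_ofP => i; rewrite ffunE; apply/dvdyP;
    exists (val i * u); rewrite expr0 mul1r.
by rewrite cardsT card_ffun card_prod card_cyclicZ // (pk_gt0 k pcharF).
Qed.

Lemma sum_selfdual_dim :
  (\sum_(i | bari i == i) residue_dim i = #|herm_R A p nu|)%N.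
Proof.
apply: expn_card_inj;
  rewrite expn_sum -(prod_selfdual_residue pcharF cardF nu_gt0 kh h_gt0 M_mod).
by apply: eq_bigr => i _; rewrite card_residue.
Qed.

Lemma avg_herm_hull_levels : avg_herm_hull F G p nu =
  (\sum_(n : {ffun I -> 'I_N.+1})
     \sum_i residue_dim i * (N - maxn (n i) (N - n (bari i))))%N%:R / (N.+1 ^ #|{:
       I}|)%N%:R.
Proof.
rewrite /avg_herm_hull abelian_codesE card_imset; last exact: code_inj.
rewrite card_ffun card_ord big_imset /=; last by move=> ? ? _ _; exact: code_inj.
congr (_ / _); rewrite natr_sum; apply: eq_big => [n|n _]; first by rewrite inE.
by rewrite code_dim_hull.
Qed.

End Codes.






(** * Averaging *)

Section SumFfun.
Variables (I J : finType).
Implicit Types (f : {ffun I -> J}) (i : I) (a b : J).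

Definition ffun_set f i a : {ffun I -> J} := [ffun l => if l == i then a else f l].

(* Exchanging the value of [f] at [i] with [a] is an involution on pairs (f, a). *)
Lemma sum_ffun_swap i (H : {ffun I -> J} -> J -> nat) :
  (\sum_(f : {ffun I -> J}) \sum_a H f a = \sum_(f : {ffun I -> J}) \sum_a H (ffun_set
    f i a) (f i))%N.
Proof.
rewrite !pair_bigA /=; pose s (fa : {ffun I -> J} * J) := (ffun_set fa.1 i fa.2, fa.1 i).
have sK : involutive s.
  case=> f a; rewrite /s /= ffunE eqxx; congr (_, _).
  by apply/ffunP => l; rewrite !ffunE; case: eqP => // ->.
by rewrite (reindex_inj (inv_inj sK)).
Qed.

(** The factor [#|J|] is an auxiliary value a; swapping it with f i leaves f free and g evaluated at
    a. *)
Lemma sum_ffun_at i (g : J -> nat) :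
  ((\sum_(f : {ffun I -> J}) g (f i)) * #|J| = #|J| ^ #|I| * \sum_a g a)%N.
Proof.
transitivity (\sum_(f : {ffun I -> J}) \sum_(a : J) g (f i))%N.
  by rewrite big_distrl; apply: eq_bigr => f _; rewrite sum_nat_const mulnC.
rewrite (sum_ffun_swap i) -card_ffun -sum_nat_const; apply: eq_bigr => f _.
by apply: eq_bigr => a _; rewrite ffunE eqxx.
Qed.

Lemma sum_ffun_at2 i l (g : J -> J -> nat) : i != l ->
  ((\sum_(f : {ffun I -> J}) g (f i) (f l)) * #|J| ^ 2 = #|J| ^ #|I| * \sum_a \sum_b g
    a b)%N.
Proof.
move=> il; rewrite -mulnn mulnA.
have -> : ((\sum_(f : {ffun I -> J}) g (f i) (f l)) * #|J| = \sum_a \sum_(f : {ffun I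
  -> J}) g a (f l))%N.
  rewrite exchange_big big_distrl /=.
  transitivity (\sum_(f : {ffun I -> J}) \sum_(a : J) g (f i) (f l))%N.
    by apply: eq_bigr => f _; rewrite sum_nat_const mulnC.
  rewrite (sum_ffun_swap i); apply: eq_bigr => f _; apply: eq_bigr => a _.
  by rewrite !ffunE eqxx eq_sym (negPf il).
rewrite big_distrl big_distrr; apply: eq_bigr => a _ /=; exact: sum_ffun_at.
Qed.
End SumFfun.

(** The summand is min(a, N - a). Passing from N to N + 2 adds two end terms equal to 0 and raises
    each inner term by 1, whence the induction by steps of 2. *)
Lemma sum_min_reflected N :
  (4 * \sum_(a < N.+1) (N - maxn a (N - a)) + odd N = N ^ 2)%N.
Proof.
elim: {N}(N./2) {-2}N (erefl N./2) => [|t IHt] N Nt.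
  case: N Nt => [|[|N]] // _; first by rewrite big_ord_recl big_ord0.
  by rewrite !big_ord_recl big_ord0.
case: N Nt => [|[|N]] // [Nt].
rewrite big_ord_recl big_ord_recr /= /bump /=.
have -> : (\sum_(i < N.+1) (N.+2 - maxn (1 + i) (N.+2 - (1 + i))) =
           \sum_(i < N.+1) (1 + (N - maxn i (N - i))))%N.
  by apply: eq_bigr => i _; have := leq_ord i; lia.
rewrite big_split /= sum_nat_const card_ord negbK.
have -> : (N.+2 - maxn 0 (N.+2 - 0) = 0)%N by lia.
have := IHt N Nt; rewrite -!mulnn; set S := (\sum_(i < _) _)%N.
by case: (odd N); nia.
Qed.

(** Reflecting a turns the summand into min(a, b); the induction then adds a last row and a last
    column. *)
Lemma sum_min_reversed N :
  (6 * \sum_(a < N.+1) \sum_(b < N.+1) (N - maxn a (N - b)) = N * N.+1 * (2 * N).+1)%N.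
Proof.
have -> : (\sum_(a < N.+1) \sum_(b < N.+1) (N - maxn a (N - b)) =
           \sum_(a < N.+1) \sum_(b < N.+1) minn a b)%N.
  rewrite (reindex_inj rev_ord_inj); apply: eq_bigr => a _; apply: eq_bigr => b _ /=.
  by have := leq_ord a; have := leq_ord b; lia.
elim: N => [|N IHN]; first by rewrite !big_ord_recl !big_ord0.
have gauss n : (2 * \sum_(a < n.+1) a = n * n.+1)%N.
  elim: n => [|n IHn]; first by rewrite big_ord_recl big_ord0.
  by rewrite big_ord_recr mulnDr IHn /=; lia.
have row (a : 'I_N.+1) :
    (\sum_(b < N.+2) minn a b = \sum_(b < N.+1) minn a b + a)%N.
  by rewrite big_ord_recr /=; congr (_ + _)%N; have := ltn_ord a; lia.
have last_row : (\sum_(b < N.+2) minn N.+1 b = \sum_(b < N.+1) b + N.+1)%N.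
  rewrite big_ord_recr /=; congr (_ + _)%N; last by lia.
  by apply: eq_bigr => b _; have := ltn_ord b; lia.
rewrite big_ord_recr /= last_row (eq_bigr _ (fun a _ => row a)) big_split /=.
move: IHN (gauss N); set S1 := (\sum_(a < _) \sum_(b < _) _)%N;
  set S2 := (\sum_(a < _) _)%N. nia.
Qed.

Lemma avg_dim_arith (m N o r s1 s2 d : rat) :
  N + 1 != 0 -> 4%:R * s1 + o = N ^+ 2 ->
  6%:R * s2 = N * (N + 1) * (2%:R * N + 1) -> o = 1 - d ->
  r * (s1 / (N + 1)) + (m - r) * (s2 / (N + 1) ^+ 2) =
  m * N * (1 / 3%:R - 1 / (6%:R * (N + 1)))
  - r * ((N + 1) / 12%:R + (2%:R - 3%:R * d) / (12%:R * (N + 1))).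
Proof.
move=> N1 E1 E2 oE.
have -> : s1 = (N ^+ 2 - (1 - d)) / 4%:R by rewrite -E1 -oE; field.
have -> : s2 = N * (N + 1) * (2%:R * N + 1) / 6%:R by rewrite -E2; field.
by field; rewrite N1.
Qed.

Lemma natr_ratio_of_eq (X c s e : nat) : (0 < c)%N -> (0 < e)%N ->
  (X * e = c * s)%N -> X%:R / c%:R = s%:R / e%:R :> rat.
Proof.
move=> c0 e0 E; have c1 : c%:R != 0 :> rat by rewrite Num.Theory.pnatr_eq0 -lt0n.
have e1 : e%:R != 0 :> rat by rewrite Num.Theory.pnatr_eq0 -lt0n.
by apply/eqP; rewrite eqr_div // -!natrM E mulnC.
Qed.

Theorem theorem4p1 (p nu k m : nat) (F : finFieldType) (A : finZmodType)
    (p_prime : prime p) (nu_gt0 : (0 < nu)%N)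
    (cardF : #|F| = (p ^ (2 * nu))%N)
    (cardA : #|A| = m) (pNm : ~~ (p %| m)%N)
    (not_2_0 : ~ (p = 2%N /\ k = 0%N)) :
  avg_herm_hull F (A * cyclicZ (p ^ k))%type p nu =
    m%:R * p%:R ^+ k * (1 / 3%:R - 1 / (6%:R * (p%:R ^+ k + 1)))
    - #|herm_R A p nu|%:R *
      ((p%:R ^+ k + 1) / 12%:R
       + (2%:R - 3%:R * delta p) / (12%:R * (p%:R ^+ k + 1))) :> rat.
Proof.
have pcharF := card_finPcharP cardF p_prime.
have m_gt0 : (0 < m)%N by case: m pNm cardA => //; rewrite dvdn0.
(* The factor [totient m] gives M = 1 modulo m by Euler; the factor [k.+1] gives h at least k. *)
pose h := (totient m * k.+1)%N.
have h_gt0 : (0 < h)%N by rewrite muln_gt0 totient_gt0 m_gt0.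
have kh : (k <= h)%N by rewrite (leq_trans (leqnSn k)) // leq_pmull // totient_gt0.
have M_mod : (#|F| ^ h = 1 %[mod #|A|])%N.
  rewrite cardA /h expnM -modnXm Euler_exp_totient ?modnXm ?exp1n //.
  by rewrite cardF coprimeXl // prime_coprime.
have p_gt0 := prime_gt0 p_prime.
rewrite (avg_herm_hull_levels pcharF cardF nu_gt0 kh h_gt0 M_mod).
set N := (p ^ k)%N; set R := galg F (A * cyclicZ N)%type.
pose I := {e : R | primidem e}.
pose bari := bar_primidem pcharF cardF : I -> I.
pose d (i : I) := residue_dim h i.
pose s1 := (\sum_(a < N.+1) (N - maxn a (N - a)))%N.
pose s2 := (\sum_(a < N.+1) \sum_(b < N.+1) (N - maxn a (N - b)))%N.
pose w (n : {ffun I -> 'I_N.+1}) (i : I) := (N - maxn (n i) (N - n (bari i)))%N.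
(* A self-conjugate component involves a single exponent, any other one two exponents that vary
   independently. *)
have w_self i : bari i = i ->
    (\sum_n w n i)%N%:R / (N.+1 ^ #|{: I}|)%N%:R = s1%:R / N.+1%:R :> rat.
  move=> ii; apply: natr_ratio_of_eq; rewrite ?expn_gt0 //.
  have := sum_ffun_at i (fun a : 'I_N.+1 => (N - maxn a (N - a))%N).
  by rewrite card_ord /w ii.
have w_pair i : bari i != i ->
    (\sum_n w n i)%N%:R / (N.+1 ^ #|{: I}|)%N%:R = s2%:R / (N.+1 ^ 2)%N%:R :> rat.
  rewrite eq_sym => ii; apply: natr_ratio_of_eq; rewrite ?expn_gt0 //.
  have := sum_ffun_at2 (fun a b : 'I_N.+1 => (N - maxn a (N - b))%N) ii.
  by rewrite card_ord.
have dimA : (\sum_i d i = m)%N.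
  by rewrite -cardA (sum_residue_dim pcharF cardF nu_gt0 kh h_gt0 M_mod).
have dimR : (\sum_(i | bari i == i) d i = #|herm_R A p nu|)%N.
  exact: (sum_selfdual_dim pcharF cardF nu_gt0 kh h_gt0 M_mod).
have dimC : (\sum_(i | bari i != i) d i)%N%:R = m%:R - #|herm_R A p nu|%:R :> rat.
  rewrite -dimA -dimR [in RHS](bigID (fun i => bari i == i)) /= natrD.
  by rewrite addrC addKr.
rewrite exchange_big /= (eq_bigr (fun i => d i * \sum_n w n i)%N); last first.
  by move=> i _; rewrite big_distrr.
rewrite natr_sum mulr_suml (bigID (fun i => bari i == i)) /=.
under eq_bigr => i /eqP ii do rewrite natrM -mulrA w_self //.
under [X in _ + X]eq_bigr => i ii do rewrite natrM -mulrA w_pair //.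
rewrite -!mulr_suml -!natr_sum dimR dimC -natr1 natrX -natr1 /N natrX.
apply: (@avg_dim_arith _ _ (odd N)%:R).
- by rewrite -natrX natr1 Num.Theory.pnatr_eq0.
- by rewrite -natrX -natrX -natrM -natrD sum_min_reflected.
- by rewrite -natrX natr1 -!natrM natr1 -natrM sum_min_reversed.
(* The parity of N is 1 - [delta p]: [not_2_0] excludes p = 2 with k = 0, where N = 1 is odd. *)
rewrite /delta /N oddX; have [p2|] := even_prime p_prime.
  have /negPf -> : k != 0%N by apply/eqP => k0; apply: not_2_0.
  by rewrite p2 subrr.
move=> po; rewrite po orbT; case: eqP => [p2|]; last by rewrite subr0.
by rewrite p2 in po.
Qed.
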